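(* Let $\mathcal{T}_1,\mathcal{T}_2,\dots$ be i.i.d. Geometric$(1/2)$-Galton–Watson trees, and let $(\tilde X,N)$ be independent of $\mathcal{T}_1,\mathcal{T}_2,\dots$ with $\tilde X$ having the size-biased Geometric$(1/2)$ distribution $\mathbb{P}(\tilde X=k)=k\,2^{-k-1}$ ($k\ge1$) and, conditionally on $\tilde X=k$, $N$ uniformly distributed on $\{1,\dots,k\}$. If $\tau_n$ is a uniformly random element of $\mathrm{Av}_n(321)$, then as $n\to\infty$ \[ \left( \sum_{i=1}^{\lfloor n/2\rfloor} \delta_i \mathbf{1}_{\{\tau_n(i)=i\}} ,\ \sum_{i=\lfloor n/2\rfloor+1}^n \delta_{n+1-i} \mathbf{1}_{\{\tau_n(i)=i\}} \right)\overset{d}{\longrightarrow} \left( \sum_{i=1}^{N-1} \delta_{\sum_{j=1}^i \#\mathcal{T}_j} \mathbf{1}_{\{\#\mathcal{T}_i=1\}},\ \sum_{i=N+1}^{\tilde X} \delta_{\sum_{j=i}^{\tilde X} \#\mathcal{T}_j} \mathbf{1}_{\{\#\mathcal{T}_{i}=1\}}\right),\] the convergence being in distribution on $\mathcal{M}_F(\{1,2,3,\dots\})^2$.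
   Context: $\mathrm{Av}_n(321)$ is the set of permutations $\tau\in S_n$ containing no indices $i<j<k$ with $\tau(i)>\tau(j)>\tau(k)$. A Geometric$(1/2)$-Galton–Watson tree is a random rooted plane (ordered) tree $T$ in which the root has a number of children with law $\xi(k)=2^{-k-1}$, $k\ge0$, and each vertex independently has children according to $\xi$; equivalently, for each finite rooted plane tree $\mathbf t$, $\mathbb{P}(T=\mathbf t)=\prod_{u\in\mathbf t}\xi(d_{\mathbf t}(u))$ where $d_{\mathbf t}(u)$ is the number of children of $u$. Such a tree is almost surely finite. $\#\mathbf t$ denotes the number of vertices of $\mathbf t$. $\delta_x$ is the unit point mass at $x$. $\mathcal{M}_F(\{1,2,3,\dots\})$ is the set of finite measures on $\{1,2,3,\dots\}$ with the topology generated by the maps $\mu\mapsto\int f\,d\mu$ for bounded $f$. *)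

(* Defs.v *)
From Stdlib Require Import Reals List.
From mathcomp Require Import ssreflect ssrfun ssrbool eqtype ssrnat seq choice fintype finfun finset fingroup perm.
Set Implicit Arguments. Unset Strict Implicit. Unset Printing Implicit Defensive.

(* Positions/values 1..n are encoded as ordinals 0..n-1 (shift by one). *)
Definition Av321 (n : nat) : pred {perm 'I_n} := fun s =>
  [forall i : 'I_n, forall j : 'I_n, forall k : 'I_n,
     ((i < j) && (j < k))%N ==> ~~ ((s j < s i) && (s k < s j))%N].

(* "tau fixes the 0-based position m" (false if m >= n) *)
Definition fixes (n : nat) (s : {perm 'I_n}) (m : nat) : bool :=
  [exists i : 'I_n, (nat_of_ord i == m) && (s i == i)].

(* A finite measure on {1,2,...} is encoded by its mass function nat -> R,
   with value 0 at 0. *)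
Definition finmeas (mu : nat -> R) : Prop :=
  mu 0%nat = 0%R /\ (forall k, (0 <= mu k)%R) /\ exists L, infinite_sum mu L.

Definition pre1 (n : nat) (s : {perm 'I_n}) : nat -> R := fun k =>
  if [&& (1 <= k)%N, (k <= n./2)%N & fixes s (k - 1)] then 1%R else 0%R.

(* sum_{i=floor(n/2)+1}^{n} delta_{n+1-i} 1{tau(i)=i}:
   point k = n+1-i, i.e. 0-based position i-1 = n-k *)
Definition pre2 (n : nat) (s : {perm 'I_n}) : nat -> R := fun k =>
  if [&& (1 <= k)%N, (k <= n - n./2)%N & fixes s (n - k)] then 1%R else 0%R.

Definition Rsumlist (l : list R) : R := fold_right Rplus 0%R l.

Definition Eperm (n : nat) (G : {perm 'I_n} -> R) : R :=
  (Rsumlist (map G (enum (@Av321 n))) / INR (size (enum (@Av321 n))))%R.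

Inductive ptree : Type := Node : list ptree -> ptree.

Fixpoint tsize (t : ptree) : nat :=
  match t with
  | Node cs => S ((fix go (l : list ptree) : nat :=
                    match l with nil => 0%nat | c :: l' => (tsize c + go l')%nat end) cs)
  end.

Definition xi (k : nat) : R := ((/2) ^ (k + 1))%R.

Fixpoint gwprob (t : ptree) : R :=
  match t with
  | Node cs => (xi (length cs) *
                (fix go (l : list ptree) : R :=
                   match l with nil => 1%R | c :: l' => (gwprob c * go l')%R end) cs)%R
  end.

(* An outcome (k, N, [t_1;...;t_k]) records Xtilde = k, N, and the first k
   trees T_1..T_k (the limit only depends on these).  Its probability is
   P(Xtilde=k) P(N=N|Xtilde=k) prod_j P(T_j=t_j)
     = k 2^{-k-1} * (1/k) * prod_j P(T_j = t_j). *)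
Definition outcome : Type := (nat * nat * list ptree)%type.

Definition Rprodlist (l : list R) : R := fold_right Rmult 1%R l.

Definition oweight (o : outcome) : R :=
  let '(k, N, ts) := o in
  if [&& (1 <= N)%N, (N <= k)%N & (length ts == k)%N] then
    (INR k * (/2) ^ (k + 1) * / INR k * Rprodlist (map gwprob ts))%R
  else 0%R.

(* #T_i, 1-based *)
Definition osz (ts : list ptree) (i : nat) : nat := tsize (nth (Node nil) ts (i - 1)).

Definition ssum (ts : list ptree) (a b : nat) : nat := sumn (map (osz ts) (iota a (b + 1 - a))).

Definition lim1 (o : outcome) : nat -> R := fun m =>
  let '(k, N, ts) := o in
  Rsumlist (map (fun i => if (ssum ts 1 i == m) && (osz ts i == 1%N) then 1%R else 0%R)
                (iota 1 (N - 1))).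

Definition lim2 (o : outcome) : nat -> R := fun m =>
  let '(k, N, ts) := o in
  Rsumlist (map (fun i => if (ssum ts i k == m) && (osz ts i == 1%N) then 1%R else 0%R)
                (iota (N + 1) (k - N))).

Definition has_sum (A : Type) (g : A -> R) (L : R) : Prop :=
  forall eps, (eps > 0)%R -> exists S0 : list A, NoDup S0 /\
    forall S : list A, NoDup S -> incl S0 S -> (Rabs (Rsumlist (map g S) - L) < eps)%R.

Definition bounded_fun (f : nat -> R) : Prop := exists B, forall k, (Rabs (f k) <= B)%R.

Definition close (f : nat -> R) (nu mu : nat -> R) (delta : R) : Prop :=
  forall c, infinite_sum (fun k => f k * (nu k - mu k))%R c -> (Rabs c < delta)%R.

(* continuity of F on M_F^2 for the product of the topologies generated by
   mu |-> int f dmu, f bounded *)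
Definition continuous_MF2 (F : (nat -> R) -> (nat -> R) -> R) : Prop :=
  forall mu1 mu2, finmeas mu1 -> finmeas mu2 ->
  forall eps, (eps > 0)%R ->
  exists (fs1 fs2 : list (nat -> R)) (delta : R),
    Forall bounded_fun fs1 /\ Forall bounded_fun fs2 /\ (delta > 0)%R /\
    forall nu1 nu2, finmeas nu1 -> finmeas nu2 ->
      Forall (fun f => close f nu1 mu1 delta) fs1 ->
      Forall (fun f => close f nu2 mu2 delta) fs2 ->
      (Rabs (F nu1 nu2 - F mu1 mu2) < eps)%R.

Definition bounded_F (F : (nat -> R) -> (nat -> R) -> R) : Prop :=
  exists B, forall mu1 mu2, (Rabs (F mu1 mu2) <= B)%R.

(* Main.v *)
Require Import Defs.
From Stdlib Require Import Reals List Lra FunctionalExtensionality.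
From HB Require Import structures.
From mathcomp Require Import ssreflect ssrfun ssrbool eqtype ssrnat seq choice fintype finfun finset fingroup perm.
From mathcomp Require Import path bigop binomial zify.
Set Implicit Arguments. Unset Strict Implicit. Unset Printing Implicit Defensive.

(** Inserting the largest value generates the 321-avoiding permutations: it
    may go anywhere inside the longest increasing suffix, and it destroys
    exactly the fixed points to its right.  Hence the fixed-point indicator
    evolves as a Markovian code, the number of codes is Catalan, and a
    surviving fixed point splits a code into two independent ones.  Plane
    forests, with the one-vertex trees playing the role of fixed points, are
    also counted by Catalan numbers and split in the same way, so the fixed
    point sets of [Av_n(321)] and the positions of the one-vertex trees of
    forests with [n] vertices agree as multisets.

    A uniform forest with [n] vertices has, with probability close to 1, the
    form [f1 ++ t :: f2] with [f1] and [f2] of bounded size; for fixed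
    [f1, f2] this has probability [C_(n-|f1|-|f2|-1) / C_n], which tends to
    [2^-(2|f1|+1) * 2^-(2|f2|+1)].  This is the law of the forests before and
    after the tree number [N] in the limit, and it has total mass 1, so the
    convergence even holds in total variation. *)

(** * Generating 321-avoiding permutations *)

(** A 321 pattern starting at a head [x] is [x] followed by a 21 pattern of entries smaller than
    [x]. *)
Definition no21_below (x : nat) : seq nat -> bool :=
  pairwise (fun y z => ~~ ((y < x) && (z < y))).

Fixpoint no321 (s : seq nat) : bool :=
  if s is x :: s' then no21_below x s' && no321 s' else true.

Definition insert_at (m p : nat) (s : seq nat) : seq nat :=
  take p s ++ m :: drop p s.

Definition fixed_seq (s : seq nat) : seq bool :=
  mkseq (fun i => nth 0 s i == i) (size s).

Lemma no321P (s : seq nat) :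
  reflect (forall i j k, i < j -> j < k -> k < size s ->
             ~~ ((nth 0 s j < nth 0 s i) && (nth 0 s k < nth 0 s j)))
          (no321 s).
Proof.
elim: s => [|x s IH] /=; first by apply: ReflectT => i j k _ _; rewrite ltn0.
apply: (iffP andP) => [[/(pairwiseP 0) H1 /IH H2] [|i] [|j] [|k] //=| H].
- by rewrite !ltnS => _ jk ks; apply: H1 => //; rewrite inE //; apply: ltn_trans jk ks.
- by rewrite !ltnS => ij jk ks; apply: H2.
split.
  apply/(pairwiseP 0) => j k; rewrite !inE => _ ks jk.
  by apply: (H 0 j.+1 k.+1).
by apply/IH => i j k ij jk ks; apply: (H i.+1 j.+1 k.+1).
Qed.

(** Being at least [x], the value [m] cannot be the upper entry of a 21 pattern below [x]; exceeding
    all entries of [s], it cannot be the lower one. *)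
Lemma no21_below_insert (x m p : nat) (s : seq nat) :
  x <= m -> all (fun y => y < m) s ->
  no21_below x (insert_at m p s) = no21_below x s.
Proof.
move=> xm sm; rewrite /no21_below /insert_at.
rewrite -[in RHS](cat_take_drop p s) !pairwise_cat /= allrel_consr.
have H1 : all (fun y => ~~ ((y < x) && (m < y))) (take p s).
  by apply/allP => y /mem_take /(allP sm) ym; lia.
have H2 : all (fun z => ~~ ((m < x) && (z < m))) (drop p s).
  by apply/allP => y _; lia.
by rewrite H1 H2.
Qed.

(** A new maximum can only play the role of the 3, so the entries after it must contain no
    descent. *)
Lemma no321_insert (m p : nat) (s : seq nat) :
  all (fun y => y < m) s -> p <= size s ->
  no321 (insert_at m p s) = sorted leq (drop p s) && no321 s.
Proof.
elim: s p => [|x s IH] [|p] //= /andP[xm sm] ps.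
  rewrite -/(sorted leq (x :: s)) sorted_pairwise; last exact: leq_trans.
  rewrite -[X in X && _]/(no21_below m (x :: s)) /no21_below.
  rewrite (@eq_in_pairwise _ [pred y | y < m] _ leq) //=; last by rewrite xm.
  by move=> y z; rewrite !inE => -> _ /=; rewrite -leqNgt.
rewrite -/(insert_at m p s) no21_below_insert ?(ltnW xm) // IH //.
by rewrite andbCA.
Qed.

Lemma size_insert_at (m p : nat) (s : seq nat) : size (insert_at m p s) = (size s).+1.
Proof. by rewrite /insert_at size_cat /= addnS -size_cat cat_take_drop. Qed.

Lemma perm_insert_at (m p : nat) (s : seq nat) : perm_eq (insert_at m p s) (m :: s).
Proof. by rewrite /insert_at perm_catC /= perm_cons perm_catC cat_take_drop. Qed.

(** Inserted before the end, [m] stands directly in front of a smaller entry, so increasing suffixes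
    now stop just after [m]: the suffix length becomes [size s - p]. *)
Lemma sorted_drop_insert_at (m j p : nat) (s : seq nat) :
  all (fun y => y < m) s -> p < size s -> sorted leq (drop p s) -> j <= (size s).+1 ->
  sorted leq (drop ((size s).+1 - j) (insert_at m p s)) = (j <= size s - p).
Proof.
move=> sm ps ss js; have szt : size (take p s) = p by rewrite size_takel // ltnW.
case: leqP => jp.
  rewrite /insert_at drop_cat szt.
  have -> : ((size s).+1 - j < p) = false by lia.
  have -> : (size s).+1 - j - p = (size s - j - p).+1 by lia.
  rewrite /= drop_drop.

  have -> : drop (size s - j - p + p) s = drop (size s - j - p) (drop p s).
    by rewrite drop_drop.
  exact: drop_sorted.
(* Here the suffix contains [m] followed by the first entry of [drop p s], which is a descent. *)
have E : drop ((size s).+1 - j) (insert_at m p s)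
    = drop ((size s).+1 - j) (take p s) ++ m :: drop p s.
  rewrite /insert_at drop_cat szt.
  case: ltnP => // h; have -> : (size s).+1 - j = p by lia.
  by rewrite subnn drop0 [drop p (take p s)]drop_oversize ?szt.
rewrite E (drop_nth 0 ps) sorted_pairwise; last exact: leq_trans.
rewrite pairwise_cat /= [in X in _ && (_ && X)]leqNgt.
have -> : nth 0 s p < m by apply: (allP sm); apply: mem_nth.
by rewrite /= !andbF.
Qed.

Lemma sorted_drop_rcons (m j : nat) (s : seq nat) :
  all (fun y => y < m) s -> j <= size s ->
  sorted leq (drop (size s - j) (rcons s m)) = sorted leq (drop (size s - j) s).
Proof.
move=> sm js; rewrite drop_rcons; last by lia.
rewrite -cats1 sorted_pairwise; last exact: leq_trans.
rewrite pairwise_cat /= andbT allrel1r sorted_pairwise; last exact: leq_trans.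
suff -> : all (leq^~ m) (drop (size s - j) s) by [].
by apply/allP => y /mem_drop /(allP sm) /ltnW.
Qed.

Lemma size_fixed_seq (s : seq nat) : size (fixed_seq s) = size s.
Proof. by rewrite size_mkseq. Qed.

Lemma fixed_seq_rcons (s : seq nat) :
  fixed_seq (rcons s (size s)) = rcons (fixed_seq s) true.
Proof.
apply: (@eq_from_nth _ false); rewrite !(size_rcons, size_fixed_seq) // => i iN.
rewrite nth_mkseq ?size_rcons // !nth_rcons size_fixed_seq.
case: ltnP => iS; first by rewrite nth_mkseq.
have -> : i = size s by lia.
by rewrite !eqxx.
Qed.

(* Strictly increasing values below [size s] leave no slack: on a sorted
   suffix every entry is at most its index, hence cannot become fixed when
   shifted to the right. *)
Lemma sorted_suffix_le (p q : nat) (s : seq nat) :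
  uniq s -> all (fun y => y < size s) s -> sorted leq (drop p s) ->
  p <= q -> q < size s -> nth 0 s q <= q.
Proof.
move=> us sm ss pq qs.
have {us} sl : sorted ltn (drop p s) by rewrite ltn_sorted_uniq_leq drop_uniq.
(* Values rise by at least one per position, so the bound [size s] on the last entry bounds all
   earlier entries of the suffix. *)
suff H d : q + d < size s -> nth 0 s q + d <= nth 0 s (q + d).
  have := H ((size s).-1 - q); rewrite subnKC; last by lia.
  have pS : (size s).-1 < size s by lia.
  have : nth 0 s (size s).-1 < size s by apply: (allP sm); apply: mem_nth.
  lia.
elim: d => [|d IH] qd; first by rewrite !addn0.
have {}IH : nth 0 s q + d <= nth 0 s (q + d) by apply: IH; lia.
have : nth 0 s (q + d) < nth 0 s (q + d.+1); last by lia.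
have /= := @sorted_ltn_nth _ ltn ltn_trans 0 (drop p s) sl (q + d - p) (q + d.+1 - p).
rewrite !inE !nth_drop size_drop !subnKC; lia.
Qed.

(** Entries left of [p] keep their status, the new maximum exceeds its index, and the entries
    shifted right were at most their old index by [sorted_suffix_le]. *)
Lemma fixed_seq_insert_at (p : nat) (s : seq nat) :
  uniq s -> all (fun y => y < size s) s -> sorted leq (drop p s) -> p < size s ->
  fixed_seq (insert_at (size s) p s)
    = take p (fixed_seq s) ++ nseq (size s - p).+1 false.
Proof.
move=> us sm ss ps; have szt : size (take p s) = p by rewrite size_takel // ltnW.
apply: (@eq_from_nth _ false).
  by rewrite size_fixed_seq size_insert_at size_cat size_nseq size_takel ?size_fixed_seq; lia.
move=> i; rewrite size_fixed_seq size_insert_at => iN.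
rewrite nth_mkseq ?size_insert_at // /insert_at !nth_cat szt.
rewrite size_takel ?size_fixed_seq ?(ltnW ps) //.
case: ltnP => ip.
  by rewrite !nth_take // nth_mkseq // (ltn_trans ip ps).
rewrite nth_nseq if_same; case E : (i - p) => [|d] /=; first by lia.
rewrite nth_drop.
have := @sorted_suffix_le p (p + d) s us sm ss; lia.
Qed.

(** The first successor appends the new maximum, which is then fixed. Otherwise [j] entries stay to
    its right: the last [j.+1] positions are not fixed and [j] is the new suffix length. *)
Definition code_step (st : nat * seq bool) : seq (nat * seq bool) :=
  (st.1.+1, true :: st.2) ::
  [seq (j, nseq j.+1 false ++ drop j st.2) | j <- iota 1 st.1].

Definition word_step (x : seq nat * (nat * seq bool)) :=
  (rcons x.1 (size x.1), (x.2.1.+1, true :: x.2.2)) ::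
  [seq (insert_at (size x.1) (size x.1 - j) x.1,
        (j, nseq j.+1 false ++ drop j x.2.2)) | j <- iota 1 x.2.1].

Fixpoint words (n : nat) : seq (seq nat * (nat * seq bool)) :=
  if n is n'.+1 then flatten [seq word_step x | x <- words n'] else [:: ([::], (0, [::]))].

(* In the reachable states [(s, (r, R))], [r] is the length of the longest
   increasing suffix of [s] and [R] is its fixed-point indicator, read from
   right to left. *)
Definition word_inv (n : nat) (x : seq nat * (nat * seq bool)) : Prop :=
  [/\ perm_eq x.1 (iota 0 n), no321 x.1, x.2.1 <= n, fixed_seq x.1 = rev x.2.2 &
      forall j, j <= n -> sorted leq (drop (n - j) x.1) = (j <= x.2.1)].

Lemma insert_at_size (m : nat) (s : seq nat) : insert_at m (size s) s = rcons s m.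
Proof. by rewrite /insert_at take_size drop_size cats1. Qed.

Lemma perm_insert_iota (n p : nat) (s : seq nat) :
  perm_eq (insert_at n p s) (iota 0 n.+1) = perm_eq s (iota 0 n).
Proof.
rewrite (permPl (perm_insert_at n p s)) -addn1 iotaD /= add0n cats1.
by rewrite perm_sym perm_rcons perm_sym perm_cons.
Qed.

Lemma perm_iota_all (n : nat) (s : seq nat) :
  perm_eq s (iota 0 n) -> all (fun y => y < n) s.
Proof. by move=> /perm_mem h; apply/allP => y; rewrite h mem_iota add0n. Qed.

Lemma word_step_inv (n : nat) (x y : seq nat * (nat * seq bool)) :
  word_inv n x -> y \in word_step x -> word_inv n.+1 y.
Proof.
case: x => s [r R] [/= sP sN rn sF sS].
have szs : size s = n by rewrite (perm_size sP) size_iota.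
have szR : size R = n by rewrite -(size_rev R) -sF size_fixed_seq.
have sA : all (fun y => y < n) s by apply: perm_iota_all.
rewrite inE szs => /orP[/eqP->|/mapP[j]].
  split => //=.
  - by rewrite -insert_at_size perm_insert_iota.
  - by rewrite -insert_at_size no321_insert // drop_size.
  - by rewrite rev_cons -sF -{1}szs fixed_seq_rcons.
  case=> [|j] jn; first by rewrite subn0 drop_oversize // size_rcons szs.
  by rewrite subSS -{1}szs sorted_drop_rcons ?szs // sS.
rewrite mem_iota /= => /andP[j0 jr] ->.
have jn : j <= n by lia.
have pn : n - j < size s by lia.
have sO : sorted leq (drop (n - j) s) by rewrite sS //; lia.
split => //=; rewrite ?perm_insert_iota //.
- by rewrite no321_insert ?szs ?sO //; lia.
- by lia.
- rewrite -{1}szs fixed_seq_insert_at ?szs //.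
  + rewrite -cat_cons -[_ :: nseq j false]/(nseq j.+1 false) rev_cat rev_nseq.
    by rewrite rev_drop szR sF subKn.
  + by rewrite (perm_uniq sP) iota_uniq.
  + by rewrite -{2}szs.
move=> i iN; have := @sorted_drop_insert_at n i (n - j) s.
rewrite szs subKn // => -> //; lia.
Qed.

Lemma words_inv (n : nat) (x : seq nat * (nat * seq bool)) :
  x \in words n -> word_inv n x.
Proof.
elim: n x => [|n IH] x /=.
  by rewrite inE => /eqP->; split=> //= j; rewrite leqn0 => /eqP->.
by case/flattenP=> _ /mapP[y /IH yI ->]; apply: word_step_inv.
Qed.

(** Removing the maximum [n] leaves a shorter 321-avoiding word, from which [s] is recovered by one
    insertion. *)
Lemma words_complete (n : nat) (s : seq nat) :
  perm_eq s (iota 0 n) -> no321 s -> s \in [seq x.1 | x <- words n].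
Proof.
elim: n s => [|n IH] s sP sN.
  by rewrite (perm_nilP sP).
have nS : n \in s by rewrite (perm_mem sP) mem_iota; lia.
pose p := index n s; pose s' := take p s ++ drop p.+1 s.
have ps : p < size s by rewrite index_mem.
have szt : size (take p s) = p by rewrite size_takel // ltnW.
have E : s = insert_at n p s'.
  rewrite /insert_at /s' take_size_cat // drop_size_cat //.
  by rewrite -[in LHS](cat_take_drop p s) (drop_nth 0 ps) nth_index.
have sP' : perm_eq s' (iota 0 n) by rewrite -(perm_insert_iota n p) -E.
have szs' : size s' = n by rewrite (perm_size sP') size_iota.
have pn : p <= n by rewrite -szs' size_cat szt leq_addr.
move: sN; rewrite E no321_insert ?szs' ?perm_iota_all // => /andP[sS sN'].
have /mapP[[s0 [r R]] xW /= Ex] := IH _ sP' sN'; rewrite -{s0}Ex in xW.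
(* The last [n - p] entries increase, so [n - p] is at most [r] and this insertion is among the
   generated ones. *)
have [_ _ _ _ /(_ (n - p))] := words_inv xW; rewrite /= subKn // leq_subr sS => /(_ erefl) rp.
apply/mapP; case: (ltnP p n) => pn'.
  exists (insert_at n p s', (n - p, nseq (n - p).+1 false ++ drop (n - p) R)) => //.
  apply/flattenP; exists (word_step (s', (r, R))); first exact: map_f.
  rewrite inE; apply/orP; right; apply/mapP; exists (n - p).
    by rewrite mem_iota /=; lia.
  by rewrite /= szs' subKn.
exists (rcons s' (size s'), (r.+1, true :: R)).
  apply/flattenP; exists (word_step (s', (r, R))); first exact: map_f.
  by rewrite inE eqxx.
by rewrite -insert_at_size szs'; congr insert_at; lia.
Qed.

Lemma insert_at_inj (n p p' : nat) (s s' : seq nat) :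
  n \notin s -> n \notin s' -> p <= size s -> p' <= size s' ->
  insert_at n p s = insert_at n p' s' -> (p = p') /\ (s = s').
Proof.
move=> ns ns' ps ps' E.
have idx q t : n \notin t -> q <= size t -> index n (insert_at n q t) = q.
  move=> nt qt; rewrite /insert_at index_cat.
  rewrite (negbTE (contra (@mem_take _ _ _ _) nt)) /= eqxx addn0.
  by rewrite size_takel.
have pp : p = p' by rewrite -(idx p s ns ps) E idx.
split=> //; subst p'.
move/eqP: E; rewrite /insert_at eqseq_cat ?size_takel // eqseq_cons eqxx /=.
by case/andP=> /eqP E1 /eqP E2; rewrite -(cat_take_drop p s) E1 E2 cat_take_drop.
Qed.

(** The index of the maximum gives the insertion place and its removal gives the parent, so no word
    is produced twice. *)
Lemma words_uniq (n : nat) : uniq [seq x.1 | x <- words n].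
Proof.
elim: n => [//|n IH]; rewrite /= map_flatten -map_comp.
have pos x : word_inv n x -> size x.1 = n /\ n \notin x.1.
  by case=> sP *; rewrite (perm_size sP) size_iota (perm_mem sP) mem_iota; lia.
have form x s : x \in words n -> s \in [seq y.1 | y <- word_step x] ->
    exists2 p, p <= n & s = insert_at n p x.1.
  move=> /words_inv /pos [szx _] /mapP[y]; rewrite inE szx => /orP[/eqP->|/mapP[j _]] -> /=.
    by exists n => //; rewrite -[in X in insert_at _ X _]szx insert_at_size.
  by exists (n - j) => //; rewrite leq_subr.
(* The induction runs over the list of parents, with the invariant and the shape of the children
   generalised to the remaining list. *)
elim: (words n) (@words_inv n) (form) IH => [//|x ws IHw] inv {}form.
rewrite map_cons cons_uniq => /andP[xn uw].
have [szx nx] := pos _ (inv _ (mem_head _ _)).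
rewrite -[flatten _]/([seq y.1 | y <- word_step x]
  ++ flatten [seq (map fst \o word_step) i | i <- ws]).
rewrite cat_uniq; apply/and3P; split.
- rewrite /word_step szx map_cons cons_uniq -map_comp.
  have [_ _ rn _ _] := inv _ (mem_head x ws).
  have inj p p' : p <= n -> p' <= n -> insert_at n p x.1 = insert_at n p' x.1 -> p = p'.
    by move=> h h' /insert_at_inj[]; rewrite ?szx.
  apply/andP; split.
    apply/mapP => -[j]; rewrite mem_iota -insert_at_size szx /= => hj /inj; lia.
  rewrite map_inj_in_uniq ?iota_uniq // => i j; rewrite !mem_iota /= => hi hj /inj; lia.
- apply/hasPn => s /flattenP[_ /mapP[y yw ->]] sy; apply/negP => sx.
  have [p pn Ep] := form _ _ (mem_head _ _) sx.
  have yI : y \in x :: ws by rewrite inE yw orbT.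
  have [q qn Eq] := form _ _ yI sy.
  have [szy ny] := pos _ (inv _ yI).
  have [||_ Exy] := insert_at_inj nx ny _ _ (etrans (esym Ep) Eq); rewrite ?szx ?szy //.
  by move: xn; rewrite Exy map_f.
- apply: IHw => // [y yw|y s yw].
    by apply: inv; rewrite inE yw orbT.
  by apply: form; rewrite inE yw orbT.
Qed.

(** * Permutations as words *)

Definition perm_word (n : nat) (s : {perm 'I_n}) : seq nat :=
  [seq val (s i) | i <- enum 'I_n].

Lemma size_perm_word (n : nat) (s : {perm 'I_n}) : size (perm_word s) = n.
Proof. by rewrite size_map size_enum_ord. Qed.

Lemma nth_perm_word (n : nat) (s : {perm 'I_n}) (i : 'I_n) :
  nth 0 (perm_word s) i = s i.
Proof. by rewrite (nth_map i) ?size_enum_ord // nth_ord_enum. Qed.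

Lemma perm_word_inj (n : nat) : injective (@perm_word n).
Proof.
by move=> s t E; apply/permP => i; apply: val_inj; rewrite /= -!nth_perm_word E.
Qed.

Lemma perm_word_iota (n : nat) (s : {perm 'I_n}) : perm_eq (perm_word s) (iota 0 n).
Proof.
apply: uniq_perm; rewrite ?iota_uniq //.
  by rewrite map_inj_uniq ?enum_uniq // => i j /val_inj /perm_inj.
move=> m; rewrite mem_iota add0n /=; apply/mapP/idP => [[i _ ->]|mn]; first exact: ltn_ord.
by exists ((s^-1)%g (Ordinal mn)); rewrite ?mem_enum // permKV.
Qed.

Lemma perm_word_surj (n : nat) (w : seq nat) :
  perm_eq w (iota 0 n) -> exists s : {perm 'I_n}, w = perm_word s.
Proof.
move=> wP; have szw : size w = n by rewrite (perm_size wP) size_iota.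
have wn (i : 'I_n) : nth 0 w i < n.
  by apply: (allP (perm_iota_all wP)); rewrite mem_nth // szw.
pose f i := Ordinal (wn i).
have fI : injective f.
  move=> i j /(congr1 val) /= /eqP; rewrite nth_uniq ?szw //; last by rewrite (perm_uniq wP) iota_uniq.
  by move/eqP/val_inj.
exists (perm fI); apply: (@eq_from_nth _ 0); rewrite ?size_perm_word // => i; rewrite szw => iN.
by rewrite (nth_perm_word _ (Ordinal iN)) permE.
Qed.

Lemma Av321_no321 (n : nat) (s : {perm 'I_n}) : Av321 s = no321 (perm_word s).
Proof.
apply/idP/no321P => [H i j k ij jk|H].
  rewrite size_perm_word => kn.
  have jn := ltn_trans jk kn; have iN := ltn_trans ij jn.
  move/forallP/(_ (Ordinal iN))/forallP/(_ (Ordinal jn))/forallP/(_ (Ordinal kn)): H.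
  by rewrite -!nth_perm_word /= ij jk.
apply/forallP => i; apply/forallP => j; apply/forallP => k.
apply/implyP => /andP[ij jk]; rewrite -!nth_perm_word.
by apply: H => //; rewrite size_perm_word.
Qed.

Lemma fixes_nth (n : nat) (s : {perm 'I_n}) (m : nat) :
  fixes s m = nth false (fixed_seq (perm_word s)) m.
Proof.
have [mn|mn] := ltnP m n; last first.
  rewrite nth_default ?size_fixed_seq ?size_perm_word //.
  by apply/existsP => -[i /andP[/eqP im _]]; have := ltn_ord i; lia.
rewrite nth_mkseq ?size_perm_word // (nth_perm_word s (Ordinal mn)).
apply/existsP/eqP => [[i /andP[/eqP im /eqP si]]|E].
  by have <- : i = Ordinal mn; [apply: val_inj | rewrite si].
by exists (Ordinal mn); rewrite /= eqxx; apply/eqP/val_inj.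
Qed.

(** * Codes and their splitting at a surviving fixed point *)

Definition codes (n : nat) : seq (nat * seq bool) := [seq x.2 | x <- words n].

(** The generated words are those of the permutations in [Av321 n], each once; [rev] appears because
    states store the indicator from right to left. *)
Lemma perm_fixed_seq_codes (n : nat) :
  perm_eq [seq fixed_seq (perm_word s) | s <- enum (@Av321 n)]
          [seq rev st.2 | st <- codes n].
Proof.
have P : perm_eq [seq perm_word s | s <- enum (@Av321 n)] [seq x.1 | x <- words n].
  apply: uniq_perm.
  - by rewrite (map_inj_uniq (@perm_word_inj n)) enum_uniq.
  - exact: words_uniq.
  move=> w; apply/mapP/idP => [[s]|].
    rewrite mem_enum -[s \in _]/(Av321 s) Av321_no321 => sN ->.
    by apply: words_complete => //; apply: perm_word_iota.
  case/mapP=> x /words_inv [xP xN _ _ _] ->.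
  have [s E] := perm_word_surj xP; exists s => //.
  by rewrite mem_enum -[s \in _]/(Av321 s) Av321_no321 -E.
have -> : [seq rev st.2 | st <- codes n] = [seq fixed_seq x.1 | x <- words n].
  by rewrite /codes -map_comp; apply/eq_in_map => x /words_inv [_ _ _ E _] /=; rewrite E.
have := perm_map fixed_seq P; by rewrite -!map_comp.
Qed.

Lemma codes_inv (n : nat) (st : nat * seq bool) :
  st \in codes n -> st.1 <= n /\ size st.2 = n.
Proof.
case/mapP=> x /words_inv [xP _ rn xF _] ->; split=> //.
by rewrite -size_rev -xF size_fixed_seq (perm_size xP) size_iota.
Qed.

Lemma codesS (n : nat) : codes n.+1 = flatten [seq code_step st | st <- codes n].
Proof.
rewrite /codes /= map_flatten -!map_comp; congr flatten.
by apply: eq_map => -[s [r R]] /=; rewrite /code_step -map_comp.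
Qed.

Fixpoint code_run (k : nat) (st : nat * seq bool) : seq (nat * seq bool) :=
  if k is k'.+1 then flatten [seq code_run k' st' | st' <- code_step st] else [:: st].

Lemma flatten_map_flatten (A B C : Type) (f : B -> seq C) (g : A -> seq B) (s : seq A) :
  flatten (map f (flatten (map g s))) = flatten [seq flatten (map f (g x)) | x <- s].
Proof. by elim: s => //= x s <-; rewrite map_cat flatten_cat. Qed.

Lemma codes_add (n k : nat) :
  codes (n + k) = flatten [seq code_run k st | st <- codes n].
Proof.
elim: k n => [|k IH] n /=.
  by rewrite addn0; elim: (codes n) => //= x s {1}->.
by rewrite addnS -addSn IH codesS flatten_map_flatten.
Qed.

Lemma codes_run (n : nat) : codes n = code_run n (0, [::]).
Proof. by rewrite -(add0n n) codes_add /= cats0. Qed.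

Definition hits (k r : nat) (R T : seq bool) : nat :=
  count (fun st => st.2 == T) (code_run k (r, R)).

Lemma hitsS (k r : nat) (R T : seq bool) :
  hits k.+1 r R T = hits k r.+1 (true :: R) T
    + \sum_(j <- iota 1 r) hits k j (nseq j.+1 false ++ drop j R) T.
Proof.
rewrite /hits [code_run k.+1 _]/= count_cat; congr (_ + _).
rewrite count_flatten -!map_comp sumnE big_map; exact: eq_bigr.
Qed.

(** Counted from the end of the list, entries never move, and a [false] never becomes [true], since
    a step prepends an entry or overwrites a prefix by [false]. As [Y] and [R1] have equal length,
    the target asks for [true] where the state has [false]. *)
Lemma hits_killed (k r : nat) (X Y R2 R1 : seq bool) :
  r <= size (X ++ false :: Y) -> size Y = size R1 ->
  hits k r (X ++ false :: Y) (R2 ++ true :: R1) = 0.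
Proof.
elim: k r X Y => [|k IH] r X Y rs YR.
  rewrite /hits /= addn0; apply/eqP; rewrite eqb0; apply/eqP => /(congr1 rev).
  move/(congr1 (fun s => nth false s (size Y))).
  rewrite !rev_cat !rev_cons !nth_cat !size_rcons !size_rev YR ltnSn.
  by rewrite -{1}YR !nth_rcons !size_rev YR ltnn eqxx.
rewrite hitsS -cat_cons (IH r.+1 (true :: X) Y rs YR).
rewrite big1_seq ?addn0 // => j /andP[_]; rewrite mem_iota => /andP[_ jr].
case: (leqP j (size X)) => jX.
  rewrite drop_cat; case: ltnP => jX'; first by rewrite catA IH // !size_cat size_nseq size_drop /=; lia.
  have -> : j - size X = 0 by lia.
  by rewrite drop0 IH // size_cat size_nseq /=; lia.
(* The marked [false] is overwritten too, but again by a [false] at the same distance from the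
   end. *)
have -> : nseq j.+1 false ++ drop j (X ++ false :: Y)
    = nseq (size X).+1 false ++ false :: (nseq (j - (size X).+1) false ++ drop (j - (size X).+1) Y).
  rewrite drop_cat ltnNge (ltnW jX) /=.
  have -> : j - size X = (j - (size X).+1).+1 by lia.
  set d := j - _; rewrite -[RHS]/(nseq (size X).+1 false ++ nseq d.+1 false ++ drop d Y).
  rewrite catA -nseqD -[LHS]/(nseq j.+1 false ++ drop d Y); congr (nseq _ _ ++ _); lia.
rewrite size_cat /= in rs.
rewrite IH // ?size_cat /= ?size_cat ?size_nseq ?size_drop; lia.
Qed.

(* A fixed point that survives shields everything below it, so the part of
   the word above it evolves like a word of its own. *)
Lemma hits_kept (k r : nat) (X Y R2 R1 : seq bool) :
  r <= size (X ++ true :: Y) -> size Y = size R1 -> size R2 = size X + k ->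
  hits k r (X ++ true :: Y) (R2 ++ true :: R1)
    = (Y == R1) * hits k (minn r (size X)) X R2.
Proof.
elim: k r X => [|k IH] r X rs YR R2X.
  rewrite /hits /= !addn0 eqseq_cat ?R2X ?addn0 // eqseq_cons.
  by rewrite andbC mulnb.
rewrite !hitsS -cat_cons (IH r.+1 (true :: X)) //=; last by rewrite R2X addSnnS.
rewrite minnSS mulnDr; congr (_ + _).
rewrite size_cat /= in rs.
(* Insertions with [j] beyond [size X] destroy the marked [true] and contribute nothing by
   [hits_killed]; the others act on [X] alone, with suffix length capped at [size X]. *)
have -> : iota 1 r = iota 1 (minn r (size X)) ++ iota (minn r (size X)).+1 (r - minn r (size X)).
  by rewrite -[(minn r (size X)).+1]add1n -iotaD; congr iota; lia.
rewrite big_cat /= [X in _ + X]big1_seq ?addn0; last first.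
  move=> j /andP[_]; rewrite mem_iota => /andP[j1 j2].
  have jX : size X < j by lia.
  have -> : drop j (X ++ true :: Y) = drop (j - (size X).+1) Y.
    rewrite drop_cat ltnNge (ltnW jX) /=.
    by have -> : j - size X = (j - (size X).+1).+1 by lia.
  set d := j - _.
  have -> : false :: nseq j false ++ drop d Y
      = nseq (size X).+1 false ++ false :: (nseq d false ++ drop d Y).
    rewrite -[RHS]/(nseq (size X).+1 false ++ nseq d.+1 false ++ drop d Y).
    rewrite catA -nseqD -[LHS]/(nseq j.+1 false ++ drop d Y); congr (nseq _ _ ++ _); lia.
  rewrite hits_killed //.
    by rewrite size_cat size_nseq /= size_cat size_nseq size_drop; lia.
  by rewrite size_cat size_nseq size_drop; lia.
rewrite big_distrr /=; apply: eq_big_seq => j; rewrite mem_iota => /andP[j0 j1].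
have jX : j <= size X by lia.
have -> : drop j (X ++ true :: Y) = drop j X ++ true :: Y.
  rewrite drop_cat; case: ltnP => // h.
  have -> : j = size X by lia.
  by rewrite subnn drop_size drop0.
have -> : false :: nseq j false ++ drop j X ++ true :: Y
    = (false :: nseq j false ++ drop j X) ++ true :: Y by rewrite /= catA.
have szD : size (false :: nseq j false ++ drop j X) = (size X).+1.
  by rewrite /= size_cat size_nseq size_drop; lia.
rewrite IH ?size_cat ?szD //; try by rewrite /=; lia.
by congr (_ * hits _ _ _ _); lia.
Qed.

Definition code_count (T : seq bool) : nat := hits (size T) 0 [::] T.

(** The run is cut after [size R1] steps. The next step must append a fixed point, and from then on
    [hits_kept] requires the lower part to be [R1] and lets the upper part start from the empty
    state. *)
Lemma code_count_cat (R2 R1 : seq bool) :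
  code_count (R2 ++ true :: R1) = code_count R1 * code_count R2.
Proof.
rewrite /code_count {1}/hits size_cat /= addnS addnC -addSn -addn1 -addnA -codes_run codes_add.
rewrite {1}/hits -codes_run count_flatten -map_comp sumnE big_map.
rewrite -sum1_count big_distrl /= [RHS]big_mkcond /=.
apply: eq_big_seq => -[r R] /codes_inv [/= rn szR].
rewrite -[LHS]/(hits (size R2).+1 r R (R2 ++ true :: R1)) hitsS.
rewrite -[true :: R]/([::] ++ true :: R) hits_kept //; last by rewrite /= szR.
rewrite minn0 big1_seq ?addn0; last first.
  move=> j /andP[_]; rewrite mem_iota => jr.
  rewrite -[nseq j.+1 _ ++ _]/([::] ++ false :: (nseq j false ++ drop j R)).
  by rewrite hits_killed //= size_cat size_nseq size_drop; lia.
by case: eqP.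
Qed.

(** * Catalan numbers and plane forests *)

(** The number of [n]-step runs of the suffix length from [r], a step leading to any of
    [1, ..., r + 1]. These are ballot numbers, and [ballot n 0] is the Catalan number C_n. *)
Fixpoint ballot (n r : nat) : nat :=
  if n is n'.+1 then \sum_(j <- iota 1 r.+1) ballot n' j else 1.

Lemma iota1_rcons (r : nat) : iota 1 r.+1 = rcons (iota 1 r) r.+1.
Proof. by rewrite -[in LHS](addn1 r) iotaD add1n cats1. Qed.

Lemma size_code_run (n r : nat) (R : seq bool) : size (code_run n (r, R)) = ballot n r.
Proof.
elim: n r R => [//|n IH] r R.
rewrite [ballot _ _]/= -[1 :: _]/(iota 1 r.+1) iota1_rcons big_rcons /=.
rewrite size_cat IH addnC; congr (_ + _).
rewrite size_flatten /shape -!map_comp sumnE big_map.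
by apply: eq_bigr => j _ /=; rewrite IH.
Qed.

Lemma ballotS0 (n : nat) : ballot n.+1 0 = ballot n 1.
Proof. by rewrite /= big_seq1. Qed.

Lemma ballotSS (n r : nat) : ballot n.+1 r.+1 = ballot n.+1 r + ballot n r.+2.
Proof.
rewrite [LHS]/= -[[:: 1, 2 & _]]/(iota 1 r.+2) iota1_rcons big_rcons /=.
by rewrite addnC.
Qed.

Arguments ballot : simpl never.

(** The generating function of [ballot] in [n] is the power [r + 1] of the Catalan series, and one
    more factor raises [r] by one. For [r = 0] this is Segner's recursion. *)
Lemma ballot_conv (n r : nat) :
  \sum_(i < n.+1) ballot i 0 * ballot (n - i) r = ballot n r.+1.
Proof.
elim: n r => [|n IH] r; first by rewrite big_ord_recl big_ord0.
have split q : (\sum_(i < n.+2) ballot i 0 * ballot (n.+1 - i) q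
    = \sum_(i < n.+1) ballot i 0 * ballot (n - i).+1 q + ballot n.+1 0).
  rewrite big_ord_recr /= subnn muln1; congr (_ + _).
  by apply: eq_bigr => i _; rewrite subSn // -ltnS.
elim: r => [|r IHr]; rewrite split.
  rewrite ballotSS addnC -IH; congr (_ + _).
  by apply: eq_bigr => i _; rewrite ballotS0.
rewrite ballotSS -IHr -IH split -addnA [_ + \sum_(i < _) _]addnC addnA -big_split /=; congr (_ + _).
by apply: eq_bigr => i _; rewrite -mulnDr ballotSS.
Qed.

(** The reflection formula for ballot numbers as a difference of binomials, with the subtracted term
    moved to the left to stay in [nat]. *)
Lemma ballot_bin (n r : nat) :
  ballot n.+1 r + 'C(n.*2 + r.+2, n) = 'C(n.*2 + r.+2, n.+1).
Proof.
elim: n r => [|n IH] r.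
  by rewrite bin0 bin1 [ballot _ _]big_const_seq count_predT size_iota iter_addn; lia.
elim: r => [|r IHr].
  rewrite ballotS0.
  have -> : n.+1.*2 + 2 = (n.*2 + 3).+1 by lia.
  rewrite !binS.
  have -> : 'C(n.*2 + 3, n.+2) = 'C(n.*2 + 3, n.+1).
    by rewrite -bin_sub; last lia; congr 'C(_, _); lia.
  by rewrite -(IH 1); lia.
rewrite ballotSS.
have -> : n.+1.*2 + r.+3 = (n.+1.*2 + r.+2).+1 by lia.
rewrite (binS (n.+1.*2 + r.+2) n) (binS (n.+1.*2 + r.+2) n.+1) -IHr.
have -> : n.+1.*2 + r.+2 = n.*2 + r.+4 by lia.
by rewrite -(IH r.+2); lia.
Qed.

Lemma ballot0_bin (n : nat) : n.+1 * ballot n 0 = 'C(n.*2, n).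
Proof.
case: n => [|n]; first by rewrite bin0.
have := ballot_bin n 0; have := mul_bin_left (n.*2 + 2) n.
have -> : n.*2 + 2 = n.+1.*2 by lia.
have -> : n.+1.*2 - n = n.+2 by lia.
by move=> E1 E2; nia.
Qed.

Lemma ballot0S (n : nat) : n.+2 * ballot n.+1 0 = (4 * n + 2) * ballot n 0.
Proof.
(* The factor [n.+1] turns both sides into central binomial coefficients through [ballot0_bin]. *)
suff : n.+1 * (n.+2 * ballot n.+1 0) = n.+1 * ((4 * n + 2) * ballot n 0).
  by move/eqP; rewrite eqn_pmul2l // => /eqP.
rewrite mulnCA [X in _ = X]mulnCA [in LHS]mulnCA !ballot0_bin.
have -> : n.+1.*2 = n.*2.+2 by lia.
rewrite binS.
have -> : 'C(n.*2.+1, n) = 'C(n.*2.+1, n.+1).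
  by rewrite -bin_sub; last lia; congr 'C(_, _); lia.
have := mul_bin_diag n.*2.+1 n; rewrite [n.*2.+1.-1]/=.
set a := 'C(_, _); set b := 'C(_, _); rewrite -muln2; nia.
Qed.

Lemma ballot0_gt0 (n : nat) : 0 < ballot n 0.
Proof. by have := ballot0_bin n; have : 0 < 'C(n.*2, n) by [rewrite bin_gt0; lia]; lia. Qed.

(** * Plane forests and their one-vertex trees *)

Fixpoint ptree_eq_dec (t u : ptree) {struct t} : decidable (t = u).
Proof.
case: t => ts; case: u => us.
have [E|E] : decidable (ts = us).
  elim: ts us => [|t ts IH] [|u us]; [by left|by right|by right|].
  case: (ptree_eq_dec t u) => [->|tu]; last by right; case.
  by case: (IH us) => [->|E]; [left|right; case].
- by left; rewrite E.
- by right; case.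
Defined.

HB.instance Definition _ := hasDecEq.Build ptree (compareP ptree_eq_dec).

Definition fsize (f : seq ptree) : nat := sumn (map tsize f).

Lemma tsizeE (f : seq ptree) : tsize (Node f) = (fsize f).+1.
Proof. by rewrite /=; congr _.+1; elim: f => //= t f ->. Qed.

Lemma fsize_cons (t : ptree) (f : seq ptree) : fsize (t :: f) = tsize t + fsize f.
Proof. by []. Qed.

Lemma fsize_cat (f g : seq ptree) : fsize (f ++ g) = fsize f + fsize g.
Proof. by rewrite /fsize map_cat sumn_cat. Qed.

Lemma tsize_gt0 (t : ptree) : 0 < tsize t. Proof. by case: t. Qed.

Lemma fsize_eq0 (f : seq ptree) : (fsize f == 0) = (f == [::]).
Proof. by case: f => // t f; rewrite fsize_cons addn_eq0 eqn0Ngt tsize_gt0. Qed.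

Lemma tsize1 (t : ptree) : (tsize t == 1) = (t == Node [::]).
Proof.
case: t => -[|u f]; first by rewrite !eqxx.
rewrite tsizeE fsize_cons; have := tsize_gt0 u.
by case: (Node (u :: f) =P Node [::]) => // _; lia.
Qed.

(* The first argument is fuel; it is irrelevant as soon as it is at least
   the size. *)
Fixpoint forests_rec (d n : nat) : seq (seq ptree) :=
  match d, n with
  | _, 0 => [:: [::]]
  | 0, _ => [::]
  | d'.+1, n'.+1 => flatten [seq [seq Node f :: g | f <- forests_rec d' i,
                                                    g <- forests_rec d' (n' - i)]
                            | i <- iota 0 n'.+1]
  end.

Definition forests (n : nat) := forests_rec n n.

Lemma mem_forests_rec (d n : nat) (f : seq ptree) :
  n <= d -> (f \in forests_rec d n) = (fsize f == n).
Proof.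
elim: d n f => [|d IH] [|n] f nd //.
- by rewrite inE fsize_eq0.
- by rewrite inE fsize_eq0.
apply/flattenP/eqP => [[l /mapP[i + ->]]|].
  rewrite mem_iota => hi /allpairsP[[g h] /= []].
  rewrite !IH; [|lia..] => /eqP gi /eqP hn ->.
  by rewrite fsize_cons tsizeE; lia.
case: f => // -[g] h; rewrite fsize_cons tsizeE => gh.
have gn : fsize g \in iota 0 n.+1 by rewrite mem_iota; lia.
exists [seq Node f :: g0 | f <- forests_rec d (fsize g), g0 <- forests_rec d (n - fsize g)].
  by apply/mapP; exists (fsize g).
by apply: (allpairs_f (fun f g0 => Node f :: g0)); rewrite IH; lia.
Qed.

Lemma flatten_uniq (A B : eqType) (F : A -> seq B) (s : seq A) :
  uniq s -> {in s, forall a, uniq (F a)} ->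
  {in s &, forall a a' x, x \in F a -> x \in F a' -> a = a'} ->
  uniq (flatten (map F s)).
Proof.
elim: s => //= a s IH /andP[as_ us] U D; rewrite cat_uniq U ?mem_head //=.
rewrite IH // ?andbT; first last.
- by move=> x y xs ys; apply: D; rewrite inE ?xs ?ys orbT.
- by move=> x xs; apply: U; rewrite inE xs orbT.
apply/hasPn => x /flattenP[_ /mapP[a' a's ->]] xa'; apply/negP => xa.
have E : a = a' by apply: (D _ _ _ _ x); rewrite ?inE ?eqxx ?a's ?orbT.
by rewrite E a's in as_.
Qed.

Lemma forests_rec_uniq (d n : nat) : n <= d -> uniq (forests_rec d n).
Proof.
elim: d n => [|d IH] [|n] nd //.
apply: flatten_uniq; first exact: iota_uniq.
  move=> i; rewrite mem_iota => hi; apply: allpairs_uniq; rewrite ?IH //; try lia.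
  by move=> [f g] [f' g'] _ _ [-> ->].
move=> i j; rewrite !mem_iota => hi hj f /allpairsP[[g h] /= [gi _ ->]].
move=> /allpairsP[[g' h'] /= [gj _ [E _]]].
move: gi gj; rewrite E !mem_forests_rec; lia.
Qed.

Lemma mem_forests (n : nat) (f : seq ptree) : (f \in forests n) = (fsize f == n).
Proof. exact: mem_forests_rec. Qed.

Lemma forests_uniq (n : nat) : uniq (forests n).
Proof. exact: forests_rec_uniq. Qed.

(** Splitting off the first tree, with [i] vertices below its root, yields the Catalan convolution
    [ballot_conv]. *)
Lemma size_forests_rec (d n : nat) : n <= d -> size (forests_rec d n) = ballot n 0.
Proof.
elim: d n => [|d IH] [|n] nd //.
rewrite [forests_rec _ _]/= -[_ ++ _]/(flatten [seq [seq Node f :: g | f <- forests_rec d i,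
   g <- forests_rec d (n - i)] | i <- iota 0 n.+1]).
rewrite size_flatten /shape -map_comp sumnE big_map.
rewrite ballotS0 -ballot_conv -(big_mkord predT (fun i => ballot i 0 * ballot (n - i) 0)).
rewrite /index_iota subn0; apply: eq_big_seq => i; rewrite mem_iota => hi.
by rewrite /= size_allpairs !IH //; lia.
Qed.

Lemma size_forests (n : nat) : size (forests n) = ballot n 0.
Proof. exact: size_forests_rec. Qed.

(** The forest counterpart of [fixed_seq]: the trees are laid out in order as blocks with one entry
    per vertex, and [true] marks the one-vertex trees. *)
Definition leaf_seq (f : seq ptree) : seq bool :=
  flatten [seq (if tsize t == 1 then [:: true] else nseq (tsize t) false) | t <- f].

Lemma leaf_seq_cons (t : ptree) (f : seq ptree) :
  leaf_seq (t :: f) = (if tsize t == 1 then [:: true] else nseq (tsize t) false) ++ leaf_seq f.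
Proof. by []. Qed.

Lemma leaf_seq_cat (f g : seq ptree) : leaf_seq (f ++ g) = leaf_seq f ++ leaf_seq g.
Proof. by rewrite /leaf_seq map_cat flatten_cat. Qed.

Lemma size_leaf_seq (f : seq ptree) : size (leaf_seq f) = fsize f.
Proof.
elim: f => // t f IH; rewrite leaf_seq_cons size_cat IH fsize_cons.
by case: eqP => [->|]; rewrite ?size_nseq.
Qed.

(** Trees have positive size, so the number of vertices before a cut determines the cut. *)
Lemma cat_fsize_inj (a b a' b' : seq ptree) :
  a ++ b = a' ++ b' -> fsize a = fsize a' -> a = a' /\ b = b'.
Proof.
elim: a a' => [|t a IH] [|t' a'] //=.
- by move=> _ /esym/eqP; rewrite -[fsize [::]]/0 fsize_eq0.
- by move=> _ /eqP; rewrite -[fsize [::]]/0 fsize_eq0.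
by case=> <- E; rewrite !fsize_cons => /addnI /(IH _ E) [-> ->].
Qed.

Lemma leaf_seq_split (f : seq ptree) (S1 S2 : seq bool) :
  leaf_seq f = S1 ++ true :: S2 ->
  exists f1 f2, [/\ f = f1 ++ Node [::] :: f2, leaf_seq f1 = S1 & leaf_seq f2 = S2].
Proof.
elim: f S1 => [|t f IH] S1; first by case: S1.
rewrite leaf_seq_cons; case: ifP => t1.
  have Et : t = Node [::] by apply/eqP; rewrite -tsize1.
  case: S1 => [|b S1] [] => [E|<- /IH[f1 [f2 [E1 E2 E3]]]].
    by exists [::], f; rewrite Et.
  by exists (t :: f1), f2; rewrite E1 leaf_seq_cons t1 E2 E3.
move=> E.
(* The block of a larger tree is all [false], so it ends before the marked [true]. *)
have kS : tsize t <= size S1.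
  rewrite leqNgt; apply/negP => h; move/(congr1 (fun s => nth false s (size S1))): E.
  by rewrite !nth_cat size_nseq h nth_nseq h ltnn subnn.
move: E; rewrite -{1}(cat_take_drop (tsize t) S1) -catA => /eqP.
rewrite eqseq_cat ?size_nseq ?size_takel // => /andP[/eqP E1 /eqP/IH[f1 [f2 [Ef E2 E3]]]].
exists (t :: f1), f2; rewrite Ef; split=> //.
by rewrite leaf_seq_cons t1 E2 E1 cat_take_drop.
Qed.

Definition forest_count (T : seq bool) : nat :=
  count (fun f => leaf_seq f == T) (forests (size T)).

(** Joining two forests by a one-vertex tree is a bijection onto the forests with this pattern:
    [leaf_seq_split] gives surjectivity, and the known sizes of the parts give injectivity. *)
Lemma forest_count_cat (S1 S2 : seq bool) :
  forest_count (S1 ++ true :: S2) = forest_count S1 * forest_count S2.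
Proof.
rewrite /forest_count -!size_filter.
set L := filter _ _; set L1 := filter _ (forests (size S1)); set L2 := filter _ (forests (size S2)).
rewrite -(size_allpairs (fun f g => f ++ Node [::] :: g)); apply/perm_size/uniq_perm.
- exact/filter_uniq/forests_uniq.
- apply: allpairs_uniq; try exact/filter_uniq/forests_uniq.
  move=> [f g] [f' g'] /allpairsP[[a b] /= [+ _ [-> _]]] /allpairsP[[a' b'] /= [+ _ [-> _]]].
  rewrite !mem_filter => /andP[/eqP Ea _] /andP[/eqP Ea' _] /cat_fsize_inj.
  by rewrite -!size_leaf_seq Ea Ea' => /(_ erefl) [-> [->]].
move=> f; rewrite mem_filter mem_forests; apply/andP/allpairsP => [[/eqP E _]|[[f1 f2] /= []]].
  have [f1 [f2 [-> E1 E2]]] := leaf_seq_split E; exists (f1, f2).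
  by rewrite !mem_filter !mem_forests -!size_leaf_seq E1 E2 !eqxx.
rewrite !mem_filter => /andP[/eqP E1 _] /andP[/eqP E2 _] ->.
by rewrite leaf_seq_cat leaf_seq_cons E1 E2 /= eqxx -size_leaf_seq leaf_seq_cat leaf_seq_cons E1 E2 /= eqxx.
Qed.

Lemma count_forests_leaf_seq (n : nat) (T : seq bool) :
  count_mem T (map leaf_seq (forests n)) = (size T == n) * forest_count T.
Proof.
rewrite count_map; case: eqP => [<-|Tn]; first by rewrite mul1n.
rewrite mul0n; apply/eqP; rewrite -leqn0 leqNgt -has_count; apply/hasPn => f.
rewrite mem_forests /= => /eqP fn; apply/eqP => fT; case: Tn.
by rewrite -fT size_leaf_seq.
Qed.

Lemma count_codes_rev (n : nat) (T : seq bool) :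
  count_mem T [seq rev st.2 | st <- codes n] = (size T == n) * code_count (rev T).
Proof.
rewrite count_map; case: eqP => [<-|Tn].
  rewrite mul1n /code_count size_rev /hits -codes_run; apply: eq_count => st /=.
  by rewrite -(inj_eq (can_inj (@revK _))) revK.
rewrite mul0n; apply/eqP; rewrite -leqn0 leqNgt -has_count; apply/hasPn => st.
by move=> /codes_inv [_ sn] /=; apply/eqP => E; case: Tn; rewrite -E size_rev.
Qed.

(* Both counts are multiplicative along fixed points and have the same
   totals, which forces equality at the one remaining word without any. *)
Lemma code_count_forest_count (T : seq bool) : code_count (rev T) = forest_count T.
Proof.
have [n] := ubnP (size T); elim: n T => // n IH T Tn.
have split S : size S <= n -> true \in S -> code_count (rev S) = forest_count S.
  move=> Sn ST; case/path.splitPr: ST Sn => S1 S2 Sn.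
  rewrite forest_count_cat rev_cat rev_cons cat_rcons code_count_cat.
  by move: Sn; rewrite size_cat /= => Sn; rewrite !IH //; lia.
have [|Tf] := boolP (true \in T); first exact: split.
(* The word without [true] is the only one of its length that [split] does not cover. *)
have ET S : size S = size T -> true \notin S -> S = T.
  have all0 U : true \notin U -> U = nseq (size U) false.
    by move=> UT; apply/all_pred1P/allP => -[] // UI; rewrite UI in UT.
  by move=> sz Sf; rewrite (all0 _ Sf) sz -all0.
pose A := [seq rev st.2 | st <- codes (size T)].
pose B := map leaf_seq (forests (size T)).
have eqAB S : S != T -> count_mem S A = count_mem S B.
  move=> ST; rewrite count_codes_rev count_forests_leaf_seq.
  case: eqP => // sz; congr (_ * _); apply: split; first by rewrite sz.
  by apply/negPn/negP => Sf; rewrite (ET S sz Sf) eqxx in ST.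
have szAB : size A = size B.
  by rewrite (size_map _ (codes _)) (size_map _ (forests _)) size_forests codes_run size_code_run.
have : count_mem T A = count_mem T B.
  (* Away from [T] the lists agree as multisets, so their equal lengths force equal multiplicity at
     [T]. *)
  have P : perm_eq (filter (predC1 T) A) (filter (predC1 T) B).
    apply/allP => S _; apply/eqP; rewrite !count_filter.
    have [->|ST] := eqVneq S T.
      by rewrite !(@eq_count _ _ pred0) ?count_pred0 // => x /=; case: eqP.
    rewrite !(@eq_count _ _ (pred1 S)) ?eqAB //= => x /=;
    by case: eqP => // ->; rewrite ST.
  have := perm_size P; rewrite !size_filter.
  have := count_predC (pred1 T) A; have := count_predC (pred1 T) B.
  rewrite szAB -[predC (pred1 T)]/(predC1 T) => /= E1 E2 E3.
  by move: E1 E2; rewrite -/(predC1 T) E3; lia.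
by rewrite count_codes_rev count_forests_leaf_seq eqxx !mul1n.
Qed.

(** The bridge between the two models: it lets averages over permutations be computed over
    forests. *)
Lemma perm_fixed_seq_leaf_seq (n : nat) :
  perm_eq [seq fixed_seq (perm_word s) | s <- enum (@Av321 n)] (map leaf_seq (forests n)).
Proof.
apply: perm_trans (perm_fixed_seq_codes n) _; apply/allP => T _; apply/eqP.
by rewrite count_codes_rev count_forests_leaf_seq code_count_forest_count.
Qed.

(** * Real sums and asymptotics *)

HB.instance Definition _ := Monoid.isComLaw.Build R 0%R Rplus
  (fun x y z => esym (Rplus_assoc x y z)) Rplus_comm Rplus_0_l.

Local Notation "\Rsum_ ( i <- s ) F" := (\big[Rplus/0%R]_(i <- s) F%R)
  (at level 41, F at level 41, i, s at level 50, format "\Rsum_ ( i  <-  s )  F").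

Lemma RsumlistE (T : Type) (f : T -> R) (s : seq T) :
  Rsumlist (map f s) = \Rsum_(x <- s) f x.
Proof. by elim: s => [|x s IH] /=; rewrite ?big_nil ?big_cons ?IH. Qed.

Lemma Rsum_distrl (T : Type) (c : R) (f : T -> R) (s : seq T) :
  \Rsum_(x <- s) (c * f x) = (c * \Rsum_(x <- s) f x)%R.
Proof.
elim: s => [|x s IH]; rewrite ?big_nil ?big_cons ?IH; first by rewrite Rmult_0_r.
by rewrite Rmult_plus_distr_l.
Qed.

Lemma Rsum_const (T : Type) (c : R) (s : seq T) :
  \Rsum_(x <- s) c = (INR (size s) * c)%R.
Proof.
elim: s => [|x s IH]; first by rewrite big_nil Rmult_0_l.
by rewrite big_cons IH -[size (x :: s)]/(size s).+1 S_INR; ring.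
Qed.

Lemma Rsum_abs_le (T : Type) (B : R) (g h : T -> R) (s : seq T) :
  (forall x, Rabs (g x) <= B * h x)%R ->
  (Rabs (\Rsum_(x <- s) g x) <= B * \Rsum_(x <- s) h x)%R.
Proof.
move=> gh; elim: s => [|x s IH].
  by rewrite !big_nil Rabs_R0 Rmult_0_r; apply: Rle_refl.
rewrite !big_cons; have := Rabs_triang (g x) (\Rsum_(y <- s) g y); have := gh x; lra.
Qed.

(** Only the terms of [s2] outside [s1] remain. With [h] a probability weight, this turns missing
    mass into an error bound for a bounded statistic. *)
Lemma Rsum_sub_abs_le (T : eqType) (B : R) (g h : T -> R) (s1 s2 : seq T) :
  uniq s1 -> uniq s2 -> {subset s1 <= s2} ->
  (forall x, Rabs (g x) <= B * h x)%R ->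
  (Rabs (\Rsum_(x <- s2) g x - \Rsum_(x <- s1) g x)
   <= B * (\Rsum_(x <- s2) h x - \Rsum_(x <- s1) h x))%R.
Proof.
move=> u1 u2 s12 gh.
have P : perm_eq s2 (s1 ++ filter (predC (mem s1)) s2).
  apply: uniq_perm => //.
    rewrite cat_uniq u1 filter_uniq // andbT /=; apply/hasPn => x.
    by rewrite mem_filter => /andP[].
  move=> x; rewrite mem_cat mem_filter /=.
  by case: (boolP (x \in s1)) => //= /s12.
rewrite !(perm_big _ P) !big_cat /=.
have := Rsum_abs_le (filter (predC (mem s1)) s2) gh.
set a := (\big[Rplus/0%R]_(x <- s1) g x); set b := (\big[Rplus/0%R]_(x <- s1) h x).
set c := (\big[Rplus/0%R]_(x <- _) g x); set d := (\big[Rplus/0%R]_(x <- _) h x) => H.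
have -> : (a + c - a = c)%R by ring.
by have -> : (b + d - b = d)%R by ring.
Qed.

Lemma Rsum_sub_le (T : eqType) (h : T -> R) (s1 s2 : seq T) :
  uniq s1 -> uniq s2 -> {subset s1 <= s2} -> (forall x, 0 <= h x)%R ->
  (\Rsum_(x <- s1) h x <= \Rsum_(x <- s2) h x)%R.
Proof.
move=> u1 u2 s12 h0; have H x : (Rabs 0 <= 1 * h x)%R by rewrite Rabs_R0; have := h0 x; lra.
have := @Rsum_sub_abs_le T 1 (fun _ => 0%R) h s1 s2 u1 u2 s12 H.
have := Rabs_pos (\Rsum_(x <- s2) 0 - \Rsum_(x <- s1) 0); lra.
Qed.

Lemma Rsum_filter (T : Type) (P : pred T) (h : T -> R) (s : seq T) :
  (forall x, ~~ P x -> h x = 0%R) ->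
  \Rsum_(x <- filter P s) h x = \Rsum_(x <- s) h x.
Proof.
move=> h0; elim: s => [//|x s IH] /=; rewrite big_cons -IH.
by case: ifPn => Px; rewrite ?big_cons // h0 // Rplus_0_l.
Qed.

Lemma Un_cv_Rsum (T : eqType) (U : T -> nat -> R) (l : T -> R) (s : seq T) :
  {in s, forall x, Un_cv (U x) (l x)} ->
  Un_cv (fun n => \Rsum_(x <- s) U x n) (\Rsum_(x <- s) l x).
Proof.
elim: s => [|x s IH] H.
  rewrite big_nil => eps e0; exists 0 => n _.
  by rewrite big_nil /R_dist Rminus_0_r Rabs_R0.
rewrite big_cons.
have HU : Un_cv (fun n => U x n + \Rsum_(y <- s) U y n)%R (l x + \Rsum_(y <- s) l y)%R.
  apply: CV_plus; first by apply: H; rewrite mem_head.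
  by apply: IH => y ys; apply: H; rewrite inE ys orbT.
by move=> eps /HU [N HN]; exists N => n /HN; rewrite big_cons.
Qed.

(** * Catalan ratios and tails *)

Definition catalan (n : nat) : R := INR (ballot n 0).

Lemma catalan_gt0 (n : nat) : (0 < catalan n)%R.
Proof. by apply: lt_0_INR; apply/ltP; apply: ballot0_gt0. Qed.

Lemma catalanS (n : nat) :
  ((INR n + 2) * catalan n.+1 = (4 * INR n + 2) * catalan n)%R.
Proof.
have := congr1 INR (ballot0S n); rewrite /catalan.
have -> : n.+2 * ballot n.+1 0 = Nat.mul n.+2 (ballot n.+1 0) by [].
have -> : (4 * n + 2) * ballot n 0 = Nat.mul (Nat.add (Nat.mul 4 n) 2) (ballot n 0) by [].
rewrite !mult_INR plus_INR mult_INR !S_INR /=; lra.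
Qed.

Lemma Un_cv_catalan_ratioS : Un_cv (fun n => catalan n / catalan n.+1)%R (/ 4)%R.
Proof.
have E n : (catalan n / catalan n.+1 = (INR n + 2) / (4 * INR n + 2))%R.
  have := catalanS n; have := catalan_gt0 n.+1; have := pos_INR n => h1 h2 h3.
  by field_simplify_eq; [lra | lra].
move=> eps e0; have [N [HN N0]] := archimed_cor1 _ e0.
exists N => n nN; rewrite /R_dist E.
have nN' : (INR N <= INR n)%R by apply: le_INR.
have N0' : (0 < INR N)%R by apply: lt_0_INR.
have -> : ((INR n + 2) / (4 * INR n + 2) - / 4 = 3 / (2 * (4 * INR n + 2)))%R.
  by field; lra.
rewrite Rabs_pos_eq; last by apply: Rlt_le; apply: Rdiv_lt_0_compat; lra.
apply: Rle_lt_trans HN; apply: (Rmult_le_reg_r (2 * (4 * INR n + 2) * INR N)).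
  by apply: Rmult_lt_0_compat; lra.
by field_simplify; try nra; lra.
Qed.

(** After a shift by [m] the ratio is a product of [m] successive ratios, each tending to 1/4. *)
Lemma Un_cv_catalan_ratio (m : nat) :
  Un_cv (fun n => catalan (n - m) / catalan n)%R ((/ 4) ^ m)%R.
Proof.
apply: (@CV_shift _ m).
have E n : (n + m)%coq_nat - m = n by rewrite -[(n + m)%coq_nat]/(n + m) addnK.
suff H : Un_cv (fun n => catalan n / catalan (n + m))%R ((/ 4) ^ m)%R.
  by move=> eps /H [N HN]; exists N => n /HN; rewrite E.
elim: m {E} => [|m IH].
  move=> eps e0; exists 0 => n _; rewrite addn0 /R_dist /Rdiv Rinv_r; last first.
    by have := catalan_gt0 n; lra.
  by rewrite /= Rminus_diag Rabs_R0.
have H2 := CV_mult _ _ _ _ IH (@CV_shift' _ m _ Un_cv_catalan_ratioS).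
rewrite /= Rmult_comm => eps /H2 [N HN]; exists N => n /HN.
rewrite -[(n + m)%coq_nat]/(n + m) addnS.
have -> : (catalan n / catalan (n + m) * (catalan (n + m) / catalan (n + m).+1)
  = catalan n / catalan (n + m).+1)%R.
  by have := catalan_gt0 (n + m); have := catalan_gt0 (n + m).+1 => h1 h2; field; lra.
by [].
Qed.

(** This is the central binomial coefficient of 2n over n divided by 4^n. By [Rsum_catalan] it is
    the mass missing from forests with fewer than [n] vertices. *)
Definition catalan_tail (n : nat) : R := ((INR n + 1) * catalan n * (/ 4) ^ n)%R.

Lemma catalan_tail0 : catalan_tail 0 = 1%R.
Proof. by rewrite /catalan_tail /catalan /=; lra. Qed.

Lemma catalan_tailS (n : nat) : ((2 * INR n + 2) * catalan_tail n.+1 = (2 * INR n + 1) * catalan_tail n)%R.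
Proof.
rewrite /catalan_tail S_INR [pow _ n.+1]/=; have := catalanS n.
set x := catalan _; set y := catalan _; set p := pow _ _; set k := INR n => E.
have -> : ((k + 1 + 1) * x * (/ 4 * p) = (k + 2) * x * p / 4)%R by field.
by rewrite E; field.
Qed.

Lemma catalan_tail_ge0 (n : nat) : (0 <= catalan_tail n)%R.
Proof.
rewrite /catalan_tail; apply: Rmult_le_pos; last by apply: pow_le; lra.
by apply: Rmult_le_pos; [have := pos_INR n; lra | apply: Rlt_le; apply: catalan_gt0].
Qed.

(** A Wallis-type bound giving decay of order n^(-1/2); the induction step rests on (2n+1)(2n+3) <=
    (2n+2)^2. *)
Lemma catalan_tail_sqr_le (n : nat) : (catalan_tail n * catalan_tail n * (2 * INR n + 1) <= 1)%R.
Proof.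
elim: n => [|n IH]; first by rewrite catalan_tail0 /=; lra.
have := catalan_tailS n; rewrite S_INR; have := pos_INR n; have := catalan_tail_ge0 n.
set k := INR n in IH *; set t := catalan_tail n in IH *; set t' := catalan_tail n.+1 => t0 k0 E.
apply: (Rmult_le_reg_r ((2 * k + 2) * (2 * k + 2))); first by nra.
have -> : (t' * t' * (2 * (k + 1) + 1) * ((2 * k + 2) * (2 * k + 2))
  = ((2 * k + 2) * t') * ((2 * k + 2) * t') * (2 * k + 3))%R by ring.
rewrite E.
have -> : ((2 * k + 1) * t * ((2 * k + 1) * t) * (2 * k + 3)
  = t * t * (2 * k + 1) * ((2 * k + 1) * (2 * k + 3)))%R by ring.
have : (0 <= (2 * k + 1) * (2 * k + 3))%R by nra.
nra.
Qed.

Lemma catalan_tail_le1 (n : nat) : (catalan_tail n <= 1)%R.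
Proof. have := catalan_tail_sqr_le n; have := catalan_tail_ge0 n; have := pos_INR n; nra. Qed.

Lemma catalan_tail_small (eps : R) : (0 < eps)%R -> exists n, (catalan_tail n < eps)%R.
Proof.
move=> e0; have e2 : (0 < eps * eps)%R by nra.
have [n [Hn n0]] := archimed_cor1 _ e2; exists n.
apply: Rnot_le_lt => h; have := catalan_tail_sqr_le n.
have n1 : (0 < INR n)%R by apply: lt_0_INR.
have : (1 < eps * eps * INR n)%R.
  apply: (Rmult_lt_reg_r (/ INR n)); first exact: Rinv_0_lt_compat.
  by rewrite Rmult_assoc Rinv_r; lra.
have : (eps * eps <= catalan_tail n * catalan_tail n)%R by nra.
nra.
Qed.

Lemma catalan_tail_mul_small (c eps : R) :
  (0 <= c)%R -> (0 < eps)%R -> exists n, (c * catalan_tail n < eps)%R.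
Proof.
(* Dividing by [c + 1] instead of [c] also covers [c = 0]. *)
move=> c0 e0; have c1 : (0 < c + 1)%R by lra.
have [n Hn] := catalan_tail_small (Rdiv_lt_0_compat _ _ e0 c1).
exists n; have := Rmult_lt_compat_r _ _ _ c1 Hn; have := catalan_tail_ge0 n.
have -> : (eps / (c + 1) * (c + 1) = eps)%R by field; lra.
lra.
Qed.

(** The sum telescopes: by [catalan_tailS] each term is [catalan_tail m - catalan_tail m.+1]. *)
Lemma Rsum_catalan (M : nat) :
  \Rsum_(m <- iota 0 M) (catalan m * (/ 2) ^ (2 * m + 1)) = (1 - catalan_tail M)%R.
Proof.
elim: M => [|M IH]; first by rewrite big_nil catalan_tail0; lra.
rewrite -addn1 iotaD big_cat big_seq1 add0n IH [M + 1 in RHS]addn1 /=.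
have -> : pow (/ 2) (2 * M + 1) = ((/ 4) ^ M * / 2)%R.
  rewrite -[2 * M + 1]/(Nat.add (Nat.mul 2 M) 1) pow_add pow_mult pow_1.
  by congr (pow _ _ * _)%R; field.
have := catalan_tailS M; rewrite {3}/catalan_tail.
set c := catalan M; set p := pow _ _; set k := INR M; have k0 := pos_INR M.
have -> : catalan_tail M = ((k + 1) * c * p)%R by [].
rewrite -/k in k0 * => E; apply: (Rmult_eq_reg_l (2 * k + 2)); last by lra.
have -> : ((2 * k + 2) * (1 - catalan_tail M.+1) = (2 * k + 2) - (2 * k + 2) * catalan_tail M.+1)%R by ring.
by rewrite E; field.
Qed.

(** * The limit *)

(** Atoms sit at 1-based positions, so [m] reads the entry of index [m.-1] and 0 carries no mass. *)
Definition mass (S : seq bool) : nat -> R := fun m =>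
  if (0 < m) && nth false S m.-1 then 1%R else 0%R.

Lemma mass_cat_block (S : seq bool) (t : ptree) (m : nat) :
  mass (S ++ (if tsize t == 1 then [:: true] else nseq (tsize t) false)) m
    = (mass S m + if ((size S + tsize t)%N == m) && (tsize t == 1%N) then 1 else 0)%R.
Proof.
have t0 := tsize_gt0 t; rewrite /mass.
case: m => [|m] /=; first by have -> : (size S + tsize t == 0) = false by [lia]; rewrite /= Rplus_0_l.
rewrite nth_cat; case: ltnP => mS.
  have -> : (size S + tsize t == m.+1) = false by lia.
  by rewrite /= Rplus_0_r.
rewrite [nth false S m]nth_default // Rplus_0_l.
case: eqP => [->|t1]; last by rewrite andbF nth_nseq if_same.
rewrite addn1 eqSS andbT; case: (eqVneq (size S) m) => [<-|Sm]; first by rewrite subnn.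
by have -> : m - size S = (m - size S).-1.+1 by [lia]; rewrite /= nth_nil.
Qed.

(** A one-vertex tree occupies the position given by the total size up to and including it. The last
    tree is peeled off, since earlier partial sums ignore it. *)
Lemma mass_leaf_seq (f : seq ptree) (m : nat) :
  Rsumlist [seq if (fsize (take i f) == m) && (tsize (nth (Node [::]) f (i - 1)) == 1)
                then 1%R else 0%R | i <- iota 1 (size f)] = mass (leaf_seq f) m.
Proof.
rewrite RsumlistE; elim/last_ind: f => [|f t IH].
  by rewrite big_nil /mass /= nth_nil andbF.
rewrite size_rcons iota1_rcons big_rcons /= take_oversize ?size_rcons //.
rewrite subn1 /= nth_rcons ltnn eqxx -!cats1 leaf_seq_cat fsize_cat /leaf_seq /= cats0 -/(leaf_seq f).
rewrite mass_cat_block size_leaf_seq /fsize /= addn0; congr (_ + _)%R.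
rewrite -IH; apply: eq_big_seq => i; rewrite mem_iota => hi.
rewrite takel_cat; last by lia.
by rewrite nth_cat; have -> : i - 1 < size f by lia.
Qed.

(** The mirror image: sizes are summed from the right, so the first tree is peeled off. *)
Lemma mass_rev_leaf_seq (f : seq ptree) (m : nat) :
  Rsumlist [seq if (fsize (drop i f) == m) && (tsize (nth (Node [::]) f i) == 1)
                then 1%R else 0%R | i <- iota 0 (size f)] = mass (rev (leaf_seq f)) m.
Proof.
rewrite RsumlistE; elim: f => [|t f IH].
  by rewrite big_nil /mass /= nth_nil andbF.
rewrite leaf_seq_cons rev_cat.
have -> : rev (if tsize t == 1 then [:: true] else nseq (tsize t) false)
    = if tsize t == 1 then [:: true] else nseq (tsize t) false.
  by case: ifP => _; rewrite ?rev_nseq.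
rewrite mass_cat_block -IH size_rev size_leaf_seq [iota _ _]/= big_cons drop0.
rewrite fsize_cons [tsize t + _]addnC Rplus_comm; congr (_ + _)%R.
by rewrite -[1]/(1 + 0) iotaDl big_map; apply: eq_bigr => i _; rewrite add1n.
Qed.

Lemma map_osz (ts : seq ptree) (a n : nat) :
  a + n <= size ts -> map (osz ts) (iota a.+1 n) = map tsize (take n (drop a ts)).
Proof.
move=> an; have sz : size (take n (drop a ts)) = n by rewrite size_takel // size_drop; lia.
apply: (@eq_from_nth _ 0); rewrite !size_map size_iota ?sz // => i iN.
rewrite (nth_map 0) ?size_iota // nth_iota // (nth_map (Node [::])) ?sz //.
by rewrite nth_take // nth_drop /osz addSn subn1.
Qed.

(** With [t] as tree number [N], the first limit measure sees only the trees before it; [lim2E] is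
    the analogue for the trees after it. *)
Lemma lim1E (k : nat) (f1 f2 : seq ptree) (t : ptree) :
  lim1 (k, (size f1).+1, f1 ++ t :: f2) = mass (leaf_seq f1).
Proof.
apply: functional_extensionality => m; rewrite /lim1 subn1 -mass_leaf_seq.
congr Rsumlist; apply/eq_in_map => i; rewrite mem_iota => hi.
have -> : ssum (f1 ++ t :: f2) 1 i = fsize (take i f1).
  rewrite /ssum addnK map_osz ?drop0 ?size_cat; last by lia.
  by rewrite takel_cat //; lia.
by rewrite /osz nth_cat; have -> : i - 1 < size f1 by lia.
Qed.

Lemma lim2E (f1 f2 : seq ptree) (t : ptree) :
  lim2 ((size f1).+1 + size f2, (size f1).+1, f1 ++ t :: f2) = mass (rev (leaf_seq f2)).
Proof.
apply: functional_extensionality => m; rewrite /lim2 -mass_rev_leaf_seq addKn addn1.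
rewrite -[(size f1).+2]addn0 iotaDl -map_comp.
congr Rsumlist; apply/eq_in_map => i; rewrite mem_iota => hi /=.
have -> : ssum (f1 ++ t :: f2) ((size f1).+2 + i) ((size f1).+1 + size f2) = fsize (drop i f2).
  rewrite /ssum addSn map_osz ?size_cat /=; last by lia.
  rewrite take_oversize ?size_drop ?size_cat /=; last by lia.
  rewrite drop_cat ltnNge; have -> : size f1 <= (size f1).+1 + i by lia.
  by have -> : (size f1).+1 + i - size f1 = i.+1 by lia.
rewrite /osz nth_cat; have -> : ((size f1).+2 + i - 1 < size f1) = false by lia.
by have -> : (size f1).+2 + i - 1 - size f1 = i.+1 by lia.
Qed.

Lemma pre1E (n : nat) (s : {perm 'I_n}) :
  pre1 s = mass (take n./2 (fixed_seq (perm_word s))).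
Proof.
apply: functional_extensionality => -[|m] //; rewrite /pre1 /mass fixes_nth subn1 /=.
case: ltnP => mn /=; first by rewrite nth_take.
by rewrite nth_default // size_take_min geq_min mn.
Qed.

Lemma pre2E (n : nat) (s : {perm 'I_n}) :
  pre2 s = mass (take (n - n./2) (rev (fixed_seq (perm_word s)))).
Proof.
apply: functional_extensionality => -[|m] //; rewrite /pre2 /mass fixes_nth /=.
case: ltnP => mn /=.
  by rewrite nth_take // nth_rev ?size_fixed_seq ?size_perm_word //; lia.
by rewrite nth_default // size_take_min geq_min mn.
Qed.

Lemma mass_take (A C : seq bool) (k p : nat) :
  size A <= p -> p <= size A + k -> mass (take p (A ++ nseq k false ++ C)) = mass A.
Proof.
move=> Ap pk; apply: functional_extensionality => -[|m] //; rewrite /mass /=.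
have [mp|mp] := ltnP m p; last first.
  rewrite nth_default ?nth_default //; first by lia.
  by rewrite size_take; case: ltnP => h; lia.
rewrite nth_take // nth_cat; case: ltnP => // mA.
rewrite nth_cat size_nseq; have -> : m - size A < k by lia.
by rewrite nth_nseq if_same nth_default.
Qed.

Definition prelimit_stat (F : (nat -> R) -> (nat -> R) -> R) (S : seq bool) : R :=
  F (mass (take (size S)./2 S)) (mass (take (size S - (size S)./2) (rev S))).

Definition limit_stat (F : (nat -> R) -> (nat -> R) -> R) (p : seq ptree * seq ptree) : R :=
  F (mass (leaf_seq p.1)) (mass (rev (leaf_seq p.2))).

(** The block of [Node g] is all [false] and covers the middle, so both cuts at the half fall inside
    it and leave exactly the two sides. *)
Lemma prelimit_stat_big (F : (nat -> R) -> (nat -> R) -> R) (f1 f2 g : seq ptree) :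
  fsize f1 + fsize f2 <= fsize g -> 0 < fsize g ->
  prelimit_stat F (leaf_seq (f1 ++ Node g :: f2)) = limit_stat F (f1, f2).
Proof.
move=> fg g0; rewrite /prelimit_stat size_leaf_seq fsize_cat fsize_cons tsizeE.
rewrite leaf_seq_cat leaf_seq_cons tsizeE eqSS -[_ == 0]negbK -lt0n g0 /limit_stat /=.
rewrite -[_ :: _ ++ _]/(nseq (fsize g).+1 false ++ leaf_seq f2).
set n := (_ + _)%N; have n2 := odd_double_half n; have on : odd n <= 1 by case: odd.
rewrite mass_take ?size_leaf_seq; try (rewrite /n in n2 on *; lia).
rewrite !rev_cat rev_nseq -catA mass_take // size_rev size_leaf_seq; rewrite /n in n2 on *; lia.
Qed.

Lemma Eperm_forests (F : (nat -> R) -> (nat -> R) -> R) (n : nat) :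
  Eperm (fun s : {perm 'I_n} => F (pre1 s) (pre2 s))
  = ((\Rsum_(f <- forests n) prelimit_stat F (leaf_seq f)) / catalan n)%R.
Proof.
have P := perm_fixed_seq_leaf_seq n; rewrite /Eperm RsumlistE.
have -> : size (enum (@Av321 n)) = ballot n 0.
  by rewrite -size_forests -(size_map leaf_seq) -(perm_size P) size_map.
congr (_ / _)%R; rewrite -(big_map leaf_seq predT (prelimit_stat F)) -(perm_big _ P) big_map.
apply: eq_bigr => s _; rewrite pre1E pre2E /prelimit_stat.
by rewrite size_fixed_seq size_perm_word.
Qed.

(** * Forests with one dominant tree *)

Definition small_forests (M : nat) : seq (seq ptree) := flatten [seq forests m | m <- iota 0 M].

Lemma mem_small_forests (M : nat) (f : seq ptree) : (f \in small_forests M) = (fsize f < M).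
Proof.
apply/flattenP/idP => [[l /mapP[m + ->]]|fM].
  by rewrite mem_iota mem_forests => /andP[_ h] /eqP->.
by exists (forests (fsize f)); rewrite ?mem_forests // map_f // mem_iota.
Qed.

Lemma small_forests_uniq (M : nat) : uniq (small_forests M).
Proof.
apply: flatten_uniq; first exact: iota_uniq.
  by move=> m _; apply: forests_uniq.
by move=> m m' _ _ f; rewrite !mem_forests => /eqP-> /eqP.
Qed.

(** The probability of [f] as a Geometric(1/2) number of independent Galton-Watson trees, which is
    also the probability of the tree [Node f]. *)
Definition fweight (f : seq ptree) : R := ((/ 2) ^ (2 * fsize f + 1))%R.

Lemma fweight_ge0 (f : seq ptree) : (0 <= fweight f)%R.
Proof. by apply: pow_le; lra. Qed.

Lemma Rsum_fweight (M : nat) : \Rsum_(f <- small_forests M) fweight f = (1 - catalan_tail M)%R.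
Proof.
rewrite -Rsum_catalan big_flatten big_map; apply: eq_bigr => m _.
rewrite /catalan -size_forests -Rsum_const; apply: eq_big_seq => f.
by rewrite mem_forests /fweight => /eqP->.
Qed.

Definition small_pairs (M : nat) : seq (seq ptree * seq ptree) :=
  [seq (f, g) | f <- small_forests M, g <- small_forests M].

Lemma small_pairs_uniq (M : nat) : uniq (small_pairs M).
Proof. by apply: allpairs_uniq; rewrite ?small_forests_uniq // => -[? ?] [? ?]. Qed.

Lemma mem_small_pairs (M : nat) (p : seq ptree * seq ptree) :
  (p \in small_pairs M) = (fsize p.1 < M) && (fsize p.2 < M).
Proof.
case: p => f g; apply/allpairsP/andP => /= [[[f' g'] /= [h1 h2 [-> ->]]]|[h1 h2]].
  by rewrite -!mem_small_forests.
by exists (f, g); rewrite !mem_small_forests.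
Qed.

Definition pweight (p : seq ptree * seq ptree) : R := (fweight p.1 * fweight p.2)%R.

Lemma pweight_ge0 (p : seq ptree * seq ptree) : (0 <= pweight p)%R.
Proof. by apply: Rmult_le_pos; apply: fweight_ge0. Qed.

Lemma Rsum_pweight (M : nat) :
  \Rsum_(p <- small_pairs M) pweight p = ((1 - catalan_tail M) * (1 - catalan_tail M))%R.
Proof.
rewrite /pweight /small_pairs big_allpairs_dep /=.
under eq_bigr => f _ do rewrite Rsum_distrl Rsum_fweight Rmult_comm.
by rewrite Rsum_distrl Rsum_fweight.
Qed.

(** The exponent counts the vertices outside [g] in [p.1 ++ Node g :: p.2], which matches the limit
    in [Un_cv_catalan_ratio]. *)
Lemma pweightE (p : seq ptree * seq ptree) :
  pweight p = ((/ 4) ^ (fsize p.1 + fsize p.2 + 1))%R.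
Proof.
rewrite /pweight /fweight.
have -> : (/ 4 = (/ 2) ^ 2)%R by field.
rewrite -pow_add -pow_mult; congr pow.
rewrite -[Nat.add _ _]/(2 * fsize p.1 + 1 + (2 * fsize p.2 + 1)).
rewrite -[Nat.mul _ _]/(2 * (fsize p.1 + fsize p.2 + 1)).
lia.
Qed.

(** If the marked places differed, one marked tree would lie in the other left side and be no larger
    than it. *)
Lemma cat_cons_big_inj (f1 f2 f1' f2' : seq ptree) (t t' : ptree) :
  f1 ++ t :: f2 = f1' ++ t' :: f2' -> fsize f1' < tsize t -> fsize f1 < tsize t' ->
  f1 = f1' /\ f2 = f2'.
Proof.
elim: f1 f1' => [|u f1 IH] [|u' f1'] //=.
- by case=> _ ->.
- by case=> -> _; rewrite fsize_cons; lia.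
- by case=> -> _ _; rewrite fsize_cons; lia.
case=> <- E; rewrite !fsize_cons => h1 h2.
have [||-> ->] := IH _ E; by [lia | lia | ].
Qed.

Definition big_forests (n M : nat) : seq (seq ptree) :=
  flatten [seq [seq p.1 ++ Node g :: p.2 | g <- forests (n - (fsize p.1 + fsize p.2 + 1))]
          | p <- small_pairs M].

Lemma big_forests_uniq (n M : nat) : 4 * M <= n -> uniq (big_forests n M).
Proof.
move=> nM; apply: flatten_uniq; first exact: small_pairs_uniq.
  move=> p _; rewrite map_inj_uniq ?forests_uniq // => g g' E.
  by case: (cat_fsize_inj E erefl) => _ [->].
move=> [f1 f2] [f1' f2']; rewrite !mem_small_pairs /= => h h' f.
case/mapP=> g; rewrite mem_forests => /eqP hg -> /mapP[g']; rewrite mem_forests => /eqP hg'.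
case/cat_cons_big_inj; rewrite ?tsizeE ?hg ?hg'; try lia.
by move=> -> ->.
Qed.

Lemma big_forests_sub (n M : nat) : 4 * M <= n -> {subset big_forests n M <= forests n}.
Proof.
move=> nM f /flattenP[l /mapP[p + ->]] /mapP[g]; rewrite mem_small_pairs mem_forests => h + ->.
by rewrite mem_forests fsize_cat fsize_cons tsizeE; lia.
Qed.

(** Grouped by their sides, the forests of one group share the same statistic and number a Catalan
    number; [4 * M <= n] makes the middle tree outweigh the sides. *)
Lemma Rsum_big_forests (F : (nat -> R) -> (nat -> R) -> R) (n M : nat) :
  4 * M <= n ->
  \Rsum_(f <- big_forests n M) prelimit_stat F (leaf_seq f)
  = \Rsum_(p <- small_pairs M) (limit_stat F p * catalan (n - (fsize p.1 + fsize p.2 + 1))).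
Proof.
move=> nM; rewrite big_flatten big_map; apply: eq_big_seq => -[f1 f2].
rewrite mem_small_pairs /= big_map => h.
rewrite Rmult_comm /catalan -size_forests -Rsum_const; apply: eq_big_seq => g.
rewrite mem_forests => /eqP hg; apply: prelimit_stat_big; lia.
Qed.

(** * The law of the outcomes *)

Lemma mem_tsize_le (t : ptree) (f : seq ptree) : t \in f -> tsize t <= fsize f.
Proof.
elim: f => [//|u f IH]; rewrite inE fsize_cons => /orP[/eqP->|/IH h]; first exact: leq_addr.
exact: leq_trans h (leq_addl _ _).
Qed.

(** The formula is assumed only for the trees of [f], so that it can serve inside the strong
    induction of [gwprobE]. *)
Lemma Rprodlist_gwprob (f : seq ptree) :
  (forall t, t \in f -> gwprob t = (2 * (/ 4) ^ tsize t)%R) ->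
  Rprodlist (map gwprob f) = (2 ^ size f * (/ 4) ^ fsize f)%R.
Proof.
elim: f => [|t f IH] H; first by rewrite /Rprodlist /=; lra.
rewrite fsize_cons -[tsize t + fsize f]/(Nat.add (tsize t) (fsize f)) pow_add.
rewrite /= -/(Rprodlist (map gwprob f)) IH; last by move=> u uf; apply: H; rewrite inE uf orbT.
by rewrite H ?mem_head //; ring.
Qed.

(** A vertex with d children contributes 2^-(d+1), and the exponents of a tree with n vertices add
    up to 2n - 1. *)
Lemma gwprobE (t : ptree) : gwprob t = (2 * (/ 4) ^ tsize t)%R.
Proof.
have [n] := ubnP (tsize t); elim: n t => // n IH [f]; rewrite tsizeE ltnS => fn.
have H := @Rprodlist_gwprob f (fun t tf => IH t (leq_ltn_trans (mem_tsize_le tf) fn)).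
have -> : gwprob (Node f) = (xi (length f) * Rprodlist (map gwprob f))%R.
  by rewrite /=; congr (_ * _)%R; elim: f {H fn} => //= t f ->.
rewrite H /xi -[length f]/(size f) -[size f + 1]/(Nat.add (size f) 1) pow_add /=.
have E : ((/ 2) ^ size f * 2 ^ size f = 1)%R.
  by rewrite -Rpow_mult_distr Rinv_l ?pow1 //; lra.
set a := pow (/ 2) _ in E *; set b := pow 2 _ in E *; set c := pow _ _.
have -> : (a * (/ 2 * 1) * (b * c) = (a * b) * c / 2)%R by field.
by rewrite E; field.
Qed.

Definition valid_outcome (o : outcome) : bool :=
  [&& 0 < o.1.2, o.1.2 <= o.1.1 & size o.2 == o.1.1].

(** Size-biasing cancels the uniform choice of [N], and the powers of 2 from the trees cancel those
    from the geometric law. *)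
Lemma oweightE (o : outcome) :
  oweight o = if valid_outcome o then fweight o.2 else 0%R.
Proof.
case: o => -[k N] ts; rewrite /oweight /valid_outcome /= -[length ts]/(size ts).
case: ifP => // /and3P[N0 Nk /eqP szk].
rewrite Rprodlist_gwprob; last by move=> t _; apply: gwprobE.
rewrite szk /fweight -[2 * fsize ts + 1]/(Nat.add (Nat.mul 2 (fsize ts)) 1).
rewrite -[k + 1]/(Nat.add k 1) (pow_add _ k) (pow_add _ (Nat.mul 2 _)) pow_mult !pow_1.
have -> : ((/ 2) ^ 2 = / 4)%R by field.
have E : ((/ 2) ^ k * 2 ^ k = 1)%R by rewrite -Rpow_mult_distr Rinv_l ?pow1 //; lra.
have k0 : (0 < INR k)%R by apply: lt_0_INR; apply/ltP; lia.
set a := pow (/ 2) _ in E *; set b := pow 2 _ in E *; set c := pow _ _.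
have -> : (INR k * (a * / 2) * / INR k * (b * c) = (a * b) * (c * / 2))%R by field; lra.
by rewrite E Rmult_1_l.
Qed.

Lemma oweight_ge0 (o : outcome) : (0 <= oweight o)%R.
Proof. by rewrite oweightE; case: ifP => _; [apply: fweight_ge0 | lra]. Qed.

Definition mk_outcome (p : seq ptree * seq ptree) (g : seq ptree) : outcome :=
  ((size p.1).+1 + size p.2, (size p.1).+1, p.1 ++ Node g :: p.2).

(** An outcome is a free triple of forests: left side, right side, and the subtrees of the marked
    root. That root supplies the two extra factors 1/2, so the weights multiply. *)
Lemma oweight_mk (p : seq ptree * seq ptree) (g : seq ptree) :
  oweight (mk_outcome p g) = (pweight p * fweight g)%R.
Proof.
rewrite oweightE /valid_outcome /= leq_addr size_cat /= addSnnS eqxx.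
rewrite /pweight /fweight fsize_cat fsize_cons tsizeE -!pow_add; congr pow.
rewrite -[Nat.add _ _]/(2 * fsize p.1 + 1 + (2 * fsize p.2 + 1) + (2 * fsize g + 1)).
lia.
Qed.

Lemma limit_stat_mk (F : (nat -> R) -> (nat -> R) -> R) (p : seq ptree * seq ptree) (g : seq ptree) :
  F (lim1 (mk_outcome p g)) (lim2 (mk_outcome p g)) = limit_stat F p.
Proof. by rewrite /mk_outcome lim1E lim2E. Qed.

Definition small_outcomes (M : nat) : seq outcome :=
  [seq mk_outcome p g | p <- small_pairs M, g <- small_forests M].

Lemma small_outcomes_uniq (M : nat) : uniq (small_outcomes M).
Proof.
apply: allpairs_uniq; rewrite ?small_pairs_uniq ?small_forests_uniq //.
move=> [[f1 f2] g] [[f1' f2'] g'] _ _ /= [_ sz /eqP].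
by rewrite eqseq_cat // => /andP[/eqP-> /eqP[-> ->]].
Qed.

Lemma mem_small_outcomes (M : nat) (o : outcome) :
  valid_outcome o -> fsize o.2 < M -> o \in small_outcomes M.
Proof.
case: o => -[k N] ts /and3P[/= N0 Nk /eqP szk] tM.
(* [N] is 1-based, so the marked tree has index [N.-1]. *)
have Ns : N.-1 < size ts by lia.
have E : take N.-1 ts ++ nth (Node [::]) ts N.-1 :: drop N ts = ts.
  by rewrite -[in drop N ts](prednK N0) -drop_nth // cat_take_drop.
case Et : (nth _ _ _) E => [g] E.
move: tM; rewrite -E fsize_cat fsize_cons tsizeE => tM.
apply/allpairsP; exists ((take N.-1 ts, drop N ts), g); split.
- by rewrite mem_small_pairs /=; lia.
- by rewrite mem_small_forests /=; lia.
have szt : size (take N.-1 ts) = N.-1 by rewrite size_takel // ltnW.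
rewrite /mk_outcome /= E szt size_drop; congr (_, _, _); lia.
Qed.

Lemma Rsum_small_outcomes (M : nat) (phi : seq ptree * seq ptree -> R) :
  \Rsum_(p <- small_pairs M) \Rsum_(g <- small_forests M) (pweight p * fweight g * phi p)
  = ((1 - catalan_tail M) * \Rsum_(p <- small_pairs M) (pweight p * phi p))%R.
Proof.
rewrite -Rsum_distrl; apply: eq_bigr => p _.
rewrite -Rsum_fweight Rmult_comm -Rsum_distrl; apply: eq_bigr => g _; ring.
Qed.

Lemma Rsum_oweight (M : nat) :
  \Rsum_(o <- small_outcomes M) oweight o = ((1 - catalan_tail M) * ((1 - catalan_tail M) * (1 - catalan_tail M)))%R.
Proof.
rewrite -Rsum_pweight.
have -> : \Rsum_(p <- small_pairs M) pweight p = \Rsum_(p <- small_pairs M) (pweight p * 1).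
  by apply: eq_bigr => p _; rewrite Rmult_1_r.
rewrite -(Rsum_small_outcomes M (fun _ => 1%R)) /small_outcomes big_allpairs_dep.
by apply: eq_bigr => p _; apply: eq_bigr => g _; rewrite oweight_mk Rmult_1_r.
Qed.

Lemma Rsum_oweight_le1 (s : seq outcome) : uniq s -> (\Rsum_(o <- s) oweight o <= 1)%R.
Proof.
move=> us; rewrite -(@Rsum_filter _ valid_outcome); last first.
  by move=> o; rewrite oweightE => /negbTE->.
(* [M] exceeds all forest sizes in [s], so the valid outcomes embed into a truncated family of known
   mass. *)
pose M := (\max_(o <- s) fsize o.2).+1.
have sub : {subset filter valid_outcome s <= small_outcomes M}.
  move=> o; rewrite mem_filter => /andP[vo os]; apply: mem_small_outcomes => //.
  by rewrite ltnS /M (big_rem _ os) leq_maxl.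
have := Rsum_sub_le (filter_uniq _ us) (small_outcomes_uniq M) sub oweight_ge0.
rewrite Rsum_oweight; have := catalan_tail_ge0 M; have := catalan_tail_le1 M.
set a := catalan_tail M => a1 a0 h; apply: (Rle_trans _ _ _ h).
have : ((1 - a) * (1 - a) <= 1)%R by nra.
have : (0 <= (1 - a) * (1 - a))%R by nra.
nra.
Qed.

Lemma In_mem (T : eqType) (x : T) (s : seq T) : In x s <-> x \in s.
Proof.
elim: s => [|y l IH] /=; first by rewrite in_nil.
rewrite inE; split=> [[->|/IH->]|/orP[/eqP->|/IH]]; rewrite ?eqxx ?orbT //; by [left|right].
Qed.

Lemma NoDup_uniq (T : eqType) (s : seq T) : NoDup s <-> uniq s.
Proof.
split; elim: s => [|x s IH] //=; try by constructor.
  by move=> H; inversion H; subst; rewrite IH // andbT; apply/negP => /In_mem.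
by case/andP=> xs us; constructor; [move/In_mem; apply/negP | apply: IH].
Qed.

(** * Truncation and convergence *)

Definition bounded_by (F : (nat -> R) -> (nat -> R) -> R) (B : R) : Prop :=
  forall mu1 mu2, (Rabs (F mu1 mu2) <= B)%R.

Lemma bounded_by_ge0 (F : (nat -> R) -> (nat -> R) -> R) (B : R) :
  bounded_by F B -> (0 <= B)%R.
Proof. by move=> /(_ (fun _ => 0%R) (fun _ => 0%R)); apply/Rle_trans/Rabs_pos. Qed.

Definition truncated_limit (F : (nat -> R) -> (nat -> R) -> R) (M : nat) : R :=
  \Rsum_(p <- small_pairs M) (pweight p * limit_stat F p).

Lemma pweight_limit_stat_le (F : (nat -> R) -> (nat -> R) -> R) (B : R) (p : seq ptree * seq ptree) :
  bounded_by F B -> (Rabs (pweight p * limit_stat F p) <= B * pweight p)%R.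
Proof.
move=> F_bounded; rewrite Rabs_mult Rabs_pos_eq; last exact: pweight_ge0.
by rewrite Rmult_comm; apply: Rmult_le_compat_r; [apply: pweight_ge0 | apply: F_bounded].
Qed.

Lemma truncated_limit_sub (F : (nat -> R) -> (nat -> R) -> R) (B : R) (M M' : nat) :
  bounded_by F B -> M <= M' ->
  (Rabs (truncated_limit F M' - truncated_limit F M) <= 2 * B * catalan_tail M)%R.
Proof.
move=> F_bounded MM; have B_ge0 := bounded_by_ge0 F_bounded.
have sub : {subset small_pairs M <= small_pairs M'}.
  by move=> p; rewrite !mem_small_pairs => /andP[h1 h2]; rewrite !(leq_trans _ MM).
have := Rsum_sub_abs_le (small_pairs_uniq M) (small_pairs_uniq M') sub
  (fun p => pweight_limit_stat_le p F_bounded).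
rewrite !Rsum_pweight => h; apply: (Rle_trans _ _ _ h).
rewrite [(2 * B)%R]Rmult_comm Rmult_assoc; apply: Rmult_le_compat_l => //.
have := catalan_tail_ge0 M; have := catalan_tail_ge0 M'.
have := catalan_tail_le1 M; have := catalan_tail_le1 M'; nra.
Qed.

(** The explicit rate makes the truncations Cauchy; the same [L] and rate then serve the sum over
    outcomes and the limit in [n]. *)
Lemma truncated_limit_cv (F : (nat -> R) -> (nat -> R) -> R) (B : R) :
  bounded_by F B -> exists L, forall M, (Rabs (truncated_limit F M - L) <= 2 * B * catalan_tail M)%R.
Proof.
move=> F_bounded; have B_ge0 := bounded_by_ge0 F_bounded.
have C : Cauchy_crit (truncated_limit F).
  move=> eps e0; have [||M HM] := @catalan_tail_mul_small (2 * B) (eps / 2); [lra..|].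
  exists M => n m /leP nM /leP mM; rewrite /R_dist.
  have := truncated_limit_sub F_bounded nM; have := truncated_limit_sub F_bounded mM.
  have := Rabs_triang (truncated_limit F n - truncated_limit F M) (truncated_limit F M - truncated_limit F m).
  rewrite (Rabs_minus_sym (truncated_limit F M) (truncated_limit F m)).
  have -> : (truncated_limit F n - truncated_limit F M + (truncated_limit F M - truncated_limit F m)
    = truncated_limit F n - truncated_limit F m)%R by ring.
  lra.
have [L HL] := R_complete _ C; exists L => M.
(* The index [maxn N M] is close to the limit and also lies beyond [M]. *)
apply: le_epsilon => eps e0; have [N HN] := HL _ e0.
have := HN (maxn N M) (leP (leq_maxl N M)); have := truncated_limit_sub F_bounded (leq_maxr N M).
rewrite /R_dist; set x := truncated_limit F _; set y := truncated_limit F M => h1 h2.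
have := Rabs_triang (y - x) (x - L); rewrite (Rabs_minus_sym y x).
have -> : (y - x + (x - L) = y - L)%R by ring.
lra.
Qed.

Lemma truncated_limit_has_sum (F : (nat -> R) -> (nat -> R) -> R) (B : R) (L : R) :
  bounded_by F B ->
  (forall M, (Rabs (truncated_limit F M - L) <= 2 * B * catalan_tail M)%R) ->
  has_sum (fun o : outcome => (oweight o * F (lim1 o) (lim2 o))%R) L.
Proof.
move=> F_bounded HL eps e0; have B_ge0 := bounded_by_ge0 F_bounded.
(* The factor 6 is 3 for the outcomes outside the truncation, 1 for the factor [1 - catalan_tail M],
   and 2 for the distance to [L]. *)
have [||M Heps] := @catalan_tail_mul_small (6 * B) eps; [lra..|].
have t0 := catalan_tail_ge0 M; have t1 := catalan_tail_le1 M.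
exists (small_outcomes M); split; first exact/NoDup_uniq/small_outcomes_uniq.
move=> S /NoDup_uniq uS incS; rewrite RsumlistE.
have sub : {subset small_outcomes M <= S}.
  by move=> o /In_mem /incS /In_mem.
have bd o : (Rabs (oweight o * F (lim1 o) (lim2 o)) <= B * oweight o)%R.
  rewrite Rabs_mult Rabs_pos_eq; last exact: oweight_ge0.
  by rewrite Rmult_comm; apply: Rmult_le_compat_r; [apply: oweight_ge0 | apply: F_bounded].
have := Rsum_sub_abs_le (small_outcomes_uniq M) uS sub bd.
rewrite Rsum_oweight.
have -> : \Rsum_(o <- small_outcomes M) (oweight o * F (lim1 o) (lim2 o))
    = ((1 - catalan_tail M) * truncated_limit F M)%R.
  rewrite /truncated_limit -Rsum_small_outcomes /small_outcomes big_allpairs_dep.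
  by apply: eq_bigr => p _; apply: eq_bigr => g _; rewrite oweight_mk limit_stat_mk.
have hX : (Rabs (truncated_limit F M) <= B)%R.
  have := Rsum_abs_le (small_pairs M) (fun p => pweight_limit_stat_le p F_bounded).
  rewrite Rsum_pweight -/(truncated_limit F M).
  move=> h; apply: (Rle_trans _ _ _ h); rewrite -[X in (_ <= X)%R]Rmult_1_r.
  by apply: Rmult_le_compat_l => //; nra.
have hS := Rsum_oweight_le1 uS; have hL := HL M.
set Y := (\big[Rplus/0%R]_(o <- S) _); set W := (\big[Rplus/0%R]_(o <- S) oweight o) in hS *.
set X := truncated_limit F M in hX hL *; set t := catalan_tail M in t0 t1 hL Heps * => h.
have h1 : (B * (W - (1 - t) * ((1 - t) * (1 - t))) <= B * (3 * t))%R.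
  apply: Rmult_le_compat_l => //.
  have : (1 - 3 * t <= (1 - t) * ((1 - t) * (1 - t)))%R.
    have : (0 <= t * t * (3 - t))%R by apply: Rmult_le_pos; nra.
    lra.
  lra.
have h2 : (Rabs ((1 - t) * X - X) <= B * t)%R.
  have -> : ((1 - t) * X - X = - (t * X))%R by ring.
  rewrite Rabs_Ropp Rabs_mult (Rabs_pos_eq t) // Rmult_comm.
  exact: Rmult_le_compat_r.
have := Rabs_triang (Y - (1 - t) * X) ((1 - t) * X - X).
have := Rabs_triang (Y - (1 - t) * X + ((1 - t) * X - X)) (X - L).
have -> : (Y - (1 - t) * X + ((1 - t) * X - X) + (X - L) = Y - L)%R by ring.
lra.
Qed.

Lemma truncated_limit_Un_cv (F : (nat -> R) -> (nat -> R) -> R) (B : R) (L : R) :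
  bounded_by F B ->
  (forall M, (Rabs (truncated_limit F M - L) <= 2 * B * catalan_tail M)%R) ->
  Un_cv (fun n => Eperm (fun s : {perm 'I_n} => F (pre1 s) (pre2 s))) L.
Proof.
move=> F_bounded HL eps e0; have B_ge0 := bounded_by_ge0 F_bounded.
(* The factor 4 is 2 for the forests outside [big_forests] and 2 for the distance to [L]. *)
have [||M Heps] := @catalan_tail_mul_small (4 * B) (eps / 2); [lra..|].
have t0 := catalan_tail_ge0 M; have t1 := catalan_tail_le1 M.
pose r n (p : seq ptree * seq ptree) :=
  (catalan (n - (fsize p.1 + fsize p.2 + 1)) / catalan n)%R.
have cvr p : Un_cv (r ^~ p) (pweight p) by rewrite pweightE; apply: Un_cv_catalan_ratio.
have cvX : Un_cv (fun n => \Rsum_(p <- small_pairs M) (limit_stat F p * r n p)) (truncated_limit F M).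
  have -> : truncated_limit F M = \Rsum_(p <- small_pairs M) (limit_stat F p * pweight p).
    by apply: eq_bigr => p _; rewrite Rmult_comm.
  apply: (@Un_cv_Rsum _ (fun p n => limit_stat F p * r n p)%R) => p _.
  apply: CV_mult (cvr p); move=> e h; exists 0 => n _.
  by rewrite /R_dist Rminus_diag Rabs_R0.
have cvW : Un_cv (fun n => \Rsum_(p <- small_pairs M) r n p)
    ((1 - catalan_tail M) * (1 - catalan_tail M))%R.
  by rewrite -Rsum_pweight; apply: (@Un_cv_Rsum _ (fun p n => r n p)).
(* The two limits in [n] cost [B * e] and [e], together [eps / 4]. *)
pose e := (eps / (4 * (B + 1)))%R.
have e1 : (0 < e)%R by apply: Rdiv_lt_0_compat; lra.
have Ee : (e * (B + 1) = eps / 4)%R by rewrite /e; field; lra.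
have [N1 H1] := cvX e e1; have [N2 H2] := cvW e e1.
exists (maxn (maxn N1 N2) (4 * M)) => n /leP; rewrite !geq_max => /andP[/andP[n1 n2] nM].
move/leP/H1: n1; move/leP/H2: n2; rewrite /R_dist Eperm_forests.
have bd f : (Rabs (prelimit_stat F (leaf_seq f)) <= B * 1)%R.
  by rewrite Rmult_1_r; apply: F_bounded.
have := Rsum_sub_abs_le (big_forests_uniq nM) (forests_uniq n) (big_forests_sub nM) bd.
rewrite Rsum_big_forests // Rsum_const Rmult_1_r size_forests -/(catalan n).
(* The cardinality is the case of the constant statistic 1. *)
have -> : \Rsum_(f <- big_forests n M) 1
    = \Rsum_(p <- small_pairs M) catalan (n - (fsize p.1 + fsize p.2 + 1)).
  have := Rsum_big_forests (fun _ _ => 1%R) nM; rewrite /prelimit_stat /limit_stat => ->.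
  by apply: eq_bigr => p _; rewrite Rmult_1_l.
have c_gt0 := catalan_gt0 n.
have -> : \Rsum_(p <- small_pairs M) (limit_stat F p * catalan (n - (fsize p.1 + fsize p.2 + 1)))
    = (catalan n * \Rsum_(p <- small_pairs M) (limit_stat F p * r n p))%R.
  by rewrite -Rsum_distrl; apply: eq_bigr => p _; rewrite /r; field; lra.
have -> : \Rsum_(p <- small_pairs M) catalan (n - (fsize p.1 + fsize p.2 + 1))
    = (catalan n * \Rsum_(p <- small_pairs M) r n p)%R.
  by rewrite -Rsum_distrl; apply: eq_bigr => p _; rewrite /r; field; lra.
have := HL M.
set X' := (\big[Rplus/0%R]_(p <- _) (limit_stat F p * r n p)%R).
set W' := (\big[Rplus/0%R]_(p <- _) r n p); set S := (\big[Rplus/0%R]_(f <- _) _).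
set c := catalan n in c_gt0 *; set X := truncated_limit F M.
set t := catalan_tail M in t0 t1 Heps * => hL h hW hX.
have {}h : (Rabs (S / c - X') <= B * (1 - W'))%R.
  apply: (Rmult_le_reg_l c) => //; rewrite -{1}(Rabs_pos_eq c); last by lra.
  rewrite -Rabs_mult.
  have -> : (c * (S / c - X') = S - c * X')%R by field; lra.
  by have -> : (c * (B * (1 - W')) = B * (c - c * W'))%R by ring.
have hB : (B * (1 - W') <= B * (2 * t + e))%R.
  by apply: Rmult_le_compat_l => //; move: hW; rewrite Rabs_minus_sym => /Rabs_def2 [h1 h2]; nra.
have := Rabs_triang (S / c - X') (X' - X); have := Rabs_triang (S / c - X' + (X' - X)) (X - L).
have -> : (S / c - X' + (X' - X) + (X - L) = S / c - L)%R by ring.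
lra.
Qed.

Theorem theorem4p1 :
  forall F : (nat -> R) -> (nat -> R) -> R,
    bounded_F F -> continuous_MF2 F ->
    exists L : R,
      has_sum (fun o : outcome => (oweight o * F (lim1 o) (lim2 o))%R) L /\
      Un_cv (fun n => Eperm (fun s : {perm 'I_n} => F (pre1 s) (pre2 s))) L.
Proof.
move=> F [B FB] _; have [L HL] := truncated_limit_cv FB; exists L; split.
  exact: truncated_limit_has_sum FB HL.
exact: truncated_limit_Un_cv FB HL.
Qed.
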